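(* Let $E = \bigcup_{n\in\omega} C\big((0,\tfrac{1}{n+2}), \tfrac{1}{n+2}\big) \subseteq \mathbb{R}^2$ be the Hawaiian earring, where $C(p,r)$ is the circle of center $p$ and radius $r$, and let $\pi_1(E) = \pi_1(E,(0,0))$. Then $\pi_1(E)$ has normal subgroups of each of the following types: (1) true $\Sigma^0_\gamma$ for each $2 \le \gamma < \omega_1$; (2) true $\Pi^0_\gamma$ for each $1\le \gamma<\omega_1$ with $\gamma \neq 2$; (3) true analytic.
   Context: For a path connected Polish space $(X,d)$ and $x\in X$, $L_x$ denotes the space of loops $l:[0,1]\to X$ with $l(0)=l(1)=x$, metrized by $\sup_{s\in[0,1]} d(l_0(s),l_1(s))$; it is a Polish space. A subgroup $G \le \pi_1(X,x)$ is said to belong to a pointclass $\Gamma$ if the set $\bigcup G \subseteq L_x$ of all loops whose homotopy class lies in $G$ belongs to $\Gamma$ as a subset of $L_x$. Borel classes of a Polish space $Z$: $\Sigma^0_1$ = open sets, $\Pi^0_1$ = closed sets; for $1<\gamma<\omega_1$, $\Sigma^0_\gamma$ = countable unions of sets in $\bigcup_{\epsilon<\gamma}\Pi^0_\epsilon$, $\Pi^0_\gamma$ = countable intersections of sets in $\bigcup_{\epsilon<\gamma}\Sigma^0_\epsilon$, $\Delta^0_\gamma = \Sigma^0_\gamma\cap\Pi^0_\gamma$. A set is true $\Sigma^0_\gamma$ (resp. true $\Pi^0_\gamma$) if it is $\Sigma^0_\gamma$ (resp. $\Pi^0_\gamma$) but is not in $\Pi^0_\gamma$ (resp. $\Sigma^0_\gamma$)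 nor in any class $\Sigma^0_\epsilon,\Pi^0_\epsilon,\Delta^0_\epsilon$ with $\epsilon<\gamma$, nor in $\Delta^0_\gamma$. A set is analytic if it is a continuous image of a Polish space; it is true analytic if it is analytic but not Borel. *)

(* Defs.v *)
From Stdlib Require Import Reals.
Open Scope R_scope.

Definition pt := (R * R)%type.

Definition dist2 (p q : pt) : R :=
  sqrt ((fst p - fst q) ^ 2 + (snd p - snd q) ^ 2).

Definition origin : pt := (0, 0).

Definition rad (n : nat) : R := / INR (n + 2).

Definition circle (c : pt) (r : R) (p : pt) : Prop := dist2 p c = r.

Definition Hawaiian (p : pt) : Prop :=
  exists n : nat, circle (0, rad n) (rad n) p.

Definition clamp01 (s : R) : R := Rmax 0 (Rmin 1 s).

(* A loop l : [0,1] -> E with l 0 = l 1 = (0,0).  We represent it by a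
   function R -> R^2 which is determined by its values on [0,1]
   (it is constant outside, l s = l (clamp01 s)), so that loops
   correspond bijectively to maps [0,1] -> E. *)
Definition is_loop (l : R -> pt) : Prop :=
  (forall s, l s = l (clamp01 s)) /\
  (forall s, 0 <= s <= 1 -> Hawaiian (l s)) /\
  (forall s eps, 0 < eps -> exists del, 0 < del /\
      forall s', 0 <= s <= 1 -> 0 <= s' <= 1 -> Rabs (s - s') < del ->
        dist2 (l s) (l s') < eps) /\
  l 0 = origin /\ l 1 = origin.

Definition Loop := { l : R -> pt | is_loop l }.

Definition lfun (l : Loop) : R -> pt := proj1_sig l.

Definition loop_dist_lt (l0 l1 : Loop) (eps : R) : Prop :=
  exists del, del < eps /\
    forall s, 0 <= s <= 1 -> dist2 (lfun l0 s) (lfun l1 s) <= del.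

Definition lopen (A : Loop -> Prop) : Prop :=
  forall l, A l -> exists eps, 0 < eps /\
    forall l', loop_dist_lt l l' eps -> A l'.

Definition lcompl (A : Loop -> Prop) : Loop -> Prop := fun l => ~ A l.

Definition homotopic (f g : R -> pt) : Prop :=
  exists H : R -> R -> pt,
    (forall s t, 0 <= s <= 1 -> 0 <= t <= 1 -> Hawaiian (H s t)) /\
    (forall s t eps, 0 < eps -> exists del, 0 < del /\
        forall s' t', 0 <= s <= 1 -> 0 <= t <= 1 ->
          0 <= s' <= 1 -> 0 <= t' <= 1 ->
          Rabs (s - s') < del -> Rabs (t - t') < del ->
          dist2 (H s t) (H s' t') < eps) /\
    (forall s, 0 <= s <= 1 -> H s 0 = f s /\ H s 1 = g s) /\
    (forall t, 0 <= t <= 1 -> H 0 t = origin /\ H 1 t = origin).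

Definition lconcat (f g : R -> pt) : R -> pt :=
  fun s => if Rle_dec s (1/2) then f (2 * s) else g (2 * s - 1).

Definition lrev (f : R -> pt) : R -> pt := fun s => f (1 - s).

Definition lconst : R -> pt := fun _ => origin.

Definition lmem (S : Loop -> Prop) (f : R -> pt) : Prop :=
  exists l : Loop, lfun l = f /\ S l.

(* S = \bigcup G for a subgroup G <= pi_1(E,(0,0)): S is a union of
   homotopy classes, and the set of classes it consists of contains the
   identity and is closed under the group product and inverses. *)
Definition union_of_subgroup (S : Loop -> Prop) : Prop :=
  (forall l1 l2 : Loop, homotopic (lfun l1) (lfun l2) -> S l1 -> S l2) /\
  lmem S lconst /\
  (forall l1 l2 : Loop, S l1 -> S l2 -> lmem S (lconcat (lfun l1) (lfun l2))) /\
  (forall l : Loop, S l -> lmem S (lrev (lfun l))).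

Definition union_of_normal_subgroup (S : Loop -> Prop) : Prop :=
  union_of_subgroup S /\
  (forall g l : Loop, S l ->
     lmem S (lconcat (lconcat (lrev (lfun g)) (lfun l)) (lfun g))).

Inductive ord : Type :=
| OZero : ord
| OSucc : ord -> ord
| OLim : (nat -> ord) -> ord.

(* the (non-strict) order on Brouwer trees: OZero = 0, OSucc a = a+1,
   OLim f = sup_n f n; this order is the order of the denoted ordinals. *)
Inductive ord_le : ord -> ord -> Prop :=
| ord_le_zero b : ord_le OZero b
| ord_le_trans a b c : ord_le a b -> ord_le b c -> ord_le a c
| ord_le_succ a b : ord_le a b -> ord_le (OSucc a) (OSucc b)
| ord_le_cocone a f n : ord_le a (f n) -> ord_le a (OLim f)
| ord_le_limiting f b : (forall n, ord_le (f n) b) -> ord_le (OLim f) b.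

Definition ord_lt (a b : ord) : Prop := ord_le (OSucc a) b.
Definition ord_eq (a b : ord) : Prop := ord_le a b /\ ord_le b a.

Definition ord1 : ord := OSucc OZero.
Definition ord2 : ord := OSucc ord1.

Inductive Sigma0 : ord -> (Loop -> Prop) -> Prop :=
| Sigma0_open g A : ord_eq g ord1 -> lopen A -> Sigma0 g A
| Sigma0_union g A (B : nat -> Loop -> Prop) :
    ord_lt ord1 g ->
    (forall n, exists e, ord_lt e g /\ Sigma0 e (lcompl (B n))) ->
    (forall l, A l <-> exists n, B n l) ->
    Sigma0 g A.

Definition Pi0 (g : ord) (A : Loop -> Prop) : Prop := Sigma0 g (lcompl A).

Definition Delta0 (g : ord) (A : Loop -> Prop) : Prop := Sigma0 g A /\ Pi0 g A.

Definition true_Sigma0 (g : ord) (A : Loop -> Prop) : Prop :=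
  Sigma0 g A /\ ~ Pi0 g A /\ ~ Delta0 g A /\
  (forall e, ord_lt e g -> ~ Sigma0 e A /\ ~ Pi0 e A /\ ~ Delta0 e A).

Definition true_Pi0 (g : ord) (A : Loop -> Prop) : Prop :=
  Pi0 g A /\ ~ Sigma0 g A /\ ~ Delta0 g A /\
  (forall e, ord_lt e g -> ~ Sigma0 e A /\ ~ Pi0 e A /\ ~ Delta0 e A).

Inductive Borel : (Loop -> Prop) -> Prop :=
| Borel_open A : lopen A -> Borel A
| Borel_compl A : Borel A -> Borel (lcompl A)
| Borel_union A (B : nat -> Loop -> Prop) :
    (forall n, Borel (B n)) -> (forall l, A l <-> exists n, B n l) -> Borel A.

(* (X,d) is a complete separable metric space; every Polish space is
   homeomorphic to such a space, and every such space is Polish. *)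
Definition polish_metric (X : Type) (d : X -> X -> R) : Prop :=
  (forall x y, 0 <= d x y) /\
  (forall x y, d x y = 0 <-> x = y) /\
  (forall x y, d x y = d y x) /\
  (forall x y z, d x z <= d x y + d y z) /\
  (forall u : nat -> X,
     (forall eps, 0 < eps -> exists N, forall m n, (N <= m)%nat -> (N <= n)%nat ->
        d (u m) (u n) < eps) ->
     exists x, forall eps, 0 < eps -> exists N, forall n, (N <= n)%nat -> d (u n) x < eps) /\
  (exists D : nat -> X, forall x eps, 0 < eps -> exists n, d x (D n) < eps).

Definition analytic (A : Loop -> Prop) : Prop :=
  exists (X : Type) (d : X -> X -> R) (f : X -> Loop),
    polish_metric X d /\
    (forall x eps, 0 < eps -> exists del, 0 < del /\
       forall y, d x y < del -> loop_dist_lt (f x) (f y) eps) /\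
    (forall l, A l <-> exists x, f x = l).

(* Main.v *)
(* Let W : pi_1(E) -> (Z/2)^omega record the winding numbers modulo 2 around all circles.  It is
   a continuous homomorphism on loops with a continuous section, so the preimage under W of a
   subgroup H is a normal subgroup of the same complexity as H.
   To x in 2^omega associate the indicator [branch x] of the set of its initial segments.  These
   vectors are linearly independent, so the span H of the branches in A meets the set of branches
   exactly in A and is at least as complex as A.  Conversely, elements of H can be decoded
   continuously on countably many closed pieces, so H is Sigma^0_g if A is (g >= 2), Pi^0_g if A is
   (g >= 3; the span of all branches is only Sigma^0_2), and analytic if A is.  Sets A of the exact
   class come from diagonalizing universal sets; for Pi^0_1 take H = 0. *)

(* Working modulo 2 serves two ends. Orientation disappears: a crossing is a symmetric relation
   between two nearby sample points, and no lifting of paths is involved. And over the two-element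
   field a reduced combination of branches is just a finite set of summands. Crossings are counted
   at the top of each circle because all circles accumulate at the origin, while a small
   neighbourhood of the top meets no other circle. The lower bounds all come from one continuous
   map, sending x to a loop with winding vector [branch x], which pulls the subgroup back to A. It
   is therefore enough to study classes on Cantor space and to transfer them both ways by preimages.
   The Pi case starts at 3 because a vector can miss the span of A in two ways: some summand is
   outside A, or the vector is no sum of branches at all. The second way is a Pi^0_2 condition
   whatever A is. *)
Require Import Defs.
From Stdlib Require Import Reals Lra Lia Psatz ZArith List Bool Arith Cantor Classical
  ClassicalEpsilon FunctionalExtensionality PropExtensionality.
From Coquelicot Require Continuity.
Open Scope R_scope.

(** * Countable ordinals as Brouwer trees *)

(* Equivalent to [ord_le], but without a transitivity rule, so that inversion is computation. *)
Fixpoint ole (a : ord) : ord -> Prop :=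
  match a with
  | OZero => fun _ => True
  | OSucc a' =>
      fix olt (b : ord) : Prop :=
        match b with
        | OZero => False
        | OSucc b' => ole a' b'
        | OLim g => exists n, olt (g n)
        end
  | OLim f => fun b => forall n, ole (f n) b
  end.

Lemma ole_lim_r a f n : ole a (f n) -> ole a (OLim f).
Proof.
  induction a as [|a IH|h IH]; simpl; intros H; auto.
  exists n; exact H.
Qed.

Lemma ole_succ_r a b : ole a b -> ole a (OSucc b).
Proof.
  revert b; induction a as [|a IHa|f IHa]; intros b; simpl; auto.
  induction b as [|b IHb|g IHb]; simpl.
  - tauto.
  - apply IHa.
  - intros [n Hn]; apply IHb in Hn.
    apply ole_lim_r with n; exact Hn.
Qed.

Lemma ole_refl a : ole a a.
Proof.
  induction a as [|a IH|f IH]; simpl; auto.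
  intros n; apply ole_lim_r with n; apply IH.
Qed.

Lemma ole_trans a b c : ole a b -> ole b c -> ole a c.
Proof.
  revert b c; induction a as [|a IHa|f IHa]; intros b c Hab Hbc; [exact I| |].
  - revert c Hbc; induction b as [|b IHb|g IHb]; intros c Hbc.
    + destruct Hab.
    + induction c as [|c IHc|h IHc].
      * destruct Hbc.
      * exact (IHa b c Hab Hbc).
      * destruct Hbc as [n Hn]; exists n; apply IHc; exact Hn.
    + destruct Hab as [n Hn]; apply (IHb n Hn c (Hbc n)).
  - intros n; exact (IHa n b c (Hab n) Hbc).
Qed.

Lemma ord_le_ole a b : ord_le a b <-> ole a b.
Proof.
  split.
  - induction 1 as [b|a b c _ IH1 _ IH2|a b _ IH|a f n _ IH|f b _ IH].
    + exact I.
    + exact (ole_trans _ _ _ IH1 IH2).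
    + exact IH.
    + exact (ole_lim_r _ _ _ IH).
    + exact IH.
  - revert b; induction a as [|a IHa|f IHa]; intros b H.
    + apply ord_le_zero.
    + induction b as [|b IHb|g IHb].
      * destruct H.
      * apply ord_le_succ, IHa, H.
      * destruct H as [n Hn]; apply ord_le_cocone with n, IHb, Hn.
    + apply ord_le_limiting; intros n; apply IHa, H.
Qed.

Lemma ord_le_refl a : ord_le a a.
Proof. apply ord_le_ole, ole_refl. Qed.

Lemma ord_lt_le a b : ord_lt a b -> ord_le a b.
Proof.
  intros H; apply ord_le_trans with (OSucc a); [|exact H].
  apply ord_le_ole, ole_succ_r, ole_refl.
Qed.

Lemma ord_lt_lim a f : ord_lt a (OLim f) -> exists n, ord_lt a (f n).
Proof.
  intros H; apply ord_le_ole in H; destruct H as [n Hn].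
  exists n; apply ord_le_ole; exact Hn.
Qed.

Lemma ord_le_or_lt a b : ord_le a b \/ ord_lt b a.
Proof.
  cut (ole a b \/ ole (OSucc b) a).
  { intros [H|H]; [left|right]; apply ord_le_ole; exact H. }
  revert b; induction a as [|a IHa|f IHa]; intros b.
  - left; exact I.
  - induction b as [|b IHb|g IHb].
    + right; exact I.
    + exact (IHa b).
    + destruct (classic (exists n, ole (OSucc a) (g n))) as [H|H].
      * left; exact H.
      * right; intros n; destruct (IHb n) as [H'|H']; [exfalso; eauto|exact H'].
  - destruct (classic (exists n, ole (OSucc b) (f n))) as [H|H].
    + right; exact H.
    + left; intros n; destruct (IHa n b) as [H'|H']; [exact H'|exfalso; eauto].
Qed.

Lemma ord_lt_wf : well_founded ord_lt.
Proof.
  intros b; induction b as [|b IHb|g IHb]; constructor; intros a H.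
  - apply ord_le_ole in H; destruct H.
  - assert (Hab : ord_le a b) by (apply ord_le_ole in H; apply ord_le_ole; exact H).
    constructor; intros c Hc; destruct IHb as [IHb]; apply IHb.
    exact (ord_le_trans _ _ _ Hc Hab).
  - apply ord_lt_lim in H; destruct H as [n Hn].
    destruct (IHb n) as [IH]; apply IH, Hn.
Qed.

Lemma ord_lt_irrefl a : ~ ord_lt a a.
Proof.
  induction a as [a IH] using (well_founded_ind ord_lt_wf).
  intros H; exact (IH a H H).
Qed.

Lemma ord_lt_le_trans a b c : ord_lt a b -> ord_le b c -> ord_lt a c.
Proof. apply ord_le_trans. Qed.

Lemma ord_le_lt_trans a b c : ord_le a b -> ord_lt b c -> ord_lt a c.
Proof. intros H; apply ord_le_trans, ord_le_succ, H. Qed.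

(** Countable cofinality: a universal set of class [g] can then be assembled from countably many
    universal sets of lower classes. The sequence need not be increasing. *)
Lemma ord_lt_cofinal_sequence (g : ord) :
  ord_lt OZero g ->
  exists h : nat -> ord, (forall n, ord_lt (h n) g) /\
    forall e, ord_lt e g -> exists n, ord_le e (h n).
Proof.
  induction g as [|g _|f IH]; intros H0.
  - apply ord_le_ole in H0; destruct H0.
  - exists (fun _ => g); split; [intros _; apply ord_le_refl|].
    intros e He; exists 0%nat; apply ord_le_ole in He; apply ord_le_ole; exact He.
  - assert (IH' : forall n, exists h : nat -> ord, (forall m, ord_lt (h m) (OLim f)) /\
        forall e, ord_lt e (f n) -> exists m, ord_le e (h m)).
    { intros n; destruct (classic (ord_lt OZero (f n))) as [H|H].
      - destruct (IH n H) as (h & Hh & Hc); exists h; split; [|exact Hc].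
        intros m; apply ord_lt_le_trans with (f n); [apply Hh|].
        apply ord_le_cocone with n, ord_le_refl.
      (* If [f n] is zero it has no predecessors to cover, so any ordinal below the limit fills its
         row. *)
      - exists (fun _ => OZero); split; [intros _; exact H0|].
        intros e He; exfalso; apply H.
        exact (ord_le_lt_trans _ _ _ (ord_le_zero e) He). }
    destruct (choice _ IH') as [h Hh].
    exists (fun n => h (fst (of_nat n)) (snd (of_nat n))); split.
    + intros n; apply (proj1 (Hh _)).
    + intros e He; apply ord_lt_lim in He; destruct He as [n Hn].
      destruct (proj2 (Hh n) e Hn) as [m Hm].
      exists (to_nat (n, m)); rewrite cancel_of_to; exact Hm.
Qed.

(** * The Borel hierarchy on Cantor space *)

Definition cantor := nat -> bool.

Definition agree {T : Type} (n : nat) (x y : nat -> T) : Prop :=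
  forall i, (i < n)%nat -> x i = y i.

Lemma agree_refl {T} n (x : nat -> T) : agree n x x.
Proof. intros i _; reflexivity. Qed.

Lemma agree_sym {T} n (x y : nat -> T) : agree n x y -> agree n y x.
Proof. intros H i Hi; symmetry; apply H, Hi. Qed.

Lemma agree_trans {T} n (x y z : nat -> T) : agree n x y -> agree n y z -> agree n x z.
Proof. intros H1 H2 i Hi; rewrite H1 by exact Hi; apply H2, Hi. Qed.

Lemma agree_le {T} m n (x y : nat -> T) : (m <= n)%nat -> agree n x y -> agree m x y.
Proof. intros Hmn H i Hi; apply H; lia. Qed.

Lemma agree_eq {T} (x y : nat -> T) : (forall n, agree n x y) -> x = y.
Proof. intros H; apply functional_extensionality; intros i; apply (H (S i)); lia. Qed.

Definition continuous_map {T U : Type} (f : (nat -> T) -> nat -> U) : Prop :=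
  forall x n, exists m, forall y, agree m x y -> agree n (f x) (f y).

Lemma continuous_map_coordinates {T U} (f : (nat -> T) -> nat -> U) :
  (forall x i, exists m, forall y, agree m x y -> f x i = f y i) -> continuous_map f.
Proof.
  intros H x n; induction n as [|n [m Hm]].
  - exists 0%nat; intros y _ i Hi; lia.
  - destruct (H x n) as [k Hk]; exists (max m k); intros y Hy i Hi.
    destruct (Nat.eq_dec i n) as [->|Hne].
    + apply Hk; apply agree_le with (2 := Hy); lia.
    + apply (Hm y); [apply agree_le with (2 := Hy)|]; lia.
Qed.

Lemma continuous_map_reindex {T U} (h : nat -> nat) (g : T -> U) :
  continuous_map (fun x i => g (x (h i))).
Proof.
  apply continuous_map_coordinates; intros x i; exists (S (h i)); intros y Hy.
  rewrite (Hy (h i)); [reflexivity|lia].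
Qed.

Lemma continuous_map_comp {T U V} (f : (nat -> U) -> nat -> V) (g : (nat -> T) -> nat -> U) :
  continuous_map f -> continuous_map g -> continuous_map (fun x => f (g x)).
Proof.
  intros Hf Hg x n; destruct (Hf (g x) n) as [m Hm]; destruct (Hg x m) as [k Hk].
  exists k; intros y Hy; apply Hm, Hk, Hy.
Qed.

Definition copen (A : cantor -> Prop) : Prop :=
  forall x, A x -> exists n, forall y, agree n x y -> A y.

Definition compl {T : Type} (A : T -> Prop) : T -> Prop := fun x => ~ A x.

Lemma pred_ext {T : Type} (A B : T -> Prop) : (forall x, A x <-> B x) -> A = B.
Proof.
  intros H; apply functional_extensionality; intros x; apply propositional_extensionality, H.
Qed.

Lemma compl_compl {T : Type} (A : T -> Prop) : compl (compl A) = A.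
Proof. apply pred_ext; intros x; unfold compl; split; [apply NNPP|tauto]. Qed.

Lemma copen_preimage f A : continuous_map f -> copen A -> copen (fun x => A (f x)).
Proof.
  intros Hf HA x Hx; destruct (HA _ Hx) as [n Hn]; destruct (Hf x n) as [m Hm].
  exists m; intros y Hy; apply Hn, Hm, Hy.
Qed.

(** Clause for clause as [Sigma0], so that classes transfer along continuous maps by induction on
    the ordinal. *)
Inductive Csig : ord -> (cantor -> Prop) -> Prop :=
| Csig_open g A : ord_eq g ord1 -> copen A -> Csig g A
| Csig_union g A (B : nat -> cantor -> Prop) :
    ord_lt ord1 g ->
    (forall n, exists e, ord_lt e g /\ Csig e (compl (B n))) ->
    (forall x, A x <-> exists n, B n x) ->
    Csig g A.

Lemma ord1_lt_not_eq g : ord_lt ord1 g -> ~ ord_eq g ord1.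
Proof.
  intros H [H' _]; apply (ord_lt_irrefl ord1); exact (ord_lt_le_trans _ _ _ H H').
Qed.

Lemma Csig_inv g A :
  Csig g A -> ord_lt ord1 g ->
  exists (B : nat -> cantor -> Prop) (e : nat -> ord),
    (forall n, ord_lt (e n) g /\ Csig (e n) (compl (B n))) /\
    A = (fun x => exists n, B n x).
Proof.
  intros H Hg; destruct H as [g A He|g A B _ HB HA].
  - exfalso; exact (ord1_lt_not_eq g Hg He).
  - destruct (choice _ HB) as [e He].
    exists B, e; split; [exact He|apply pred_ext, HA].
Qed.

Lemma Csig_ge1 g A : Csig g A -> ord_le ord1 g.
Proof.
  intros [g' A' [_ H] _|g' A' B H _ _]; [exact H|apply ord_lt_le, H].
Qed.

Lemma Csig_inv_open g A : Csig g A -> ord_eq g ord1 -> copen A.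
Proof.
  intros H Hg; destruct H as [g A He HA|g A B H _ _]; [exact HA|].
  exfalso; exact (ord1_lt_not_eq g H Hg).
Qed.

Lemma ord1_eq_or_lt g : ord_le ord1 g -> ord_eq g ord1 \/ ord_lt ord1 g.
Proof.
  intros H; destruct (ord_le_or_lt g ord1) as [H'|H']; [left; split|right]; assumption.
Qed.

Lemma ord1_eq_refl : ord_eq ord1 ord1.
Proof. split; apply ord_le_refl. Qed.

(* The set of points whose [n]-th basic neighbourhood lies in [A] is clopen. *)
Lemma Csig_open_ge1 g A : ord_le ord1 g -> copen A -> Csig g A.
Proof.
  intros Hg HA; destruct (ord1_eq_or_lt g Hg) as [He|Hl].
  - apply Csig_open; assumption.
  - apply Csig_union with (B := fun n x => forall y, agree n x y -> A y); [exact Hl| |].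
    + intros n; exists ord1; split; [exact Hl|].
      apply Csig_open; [apply ord1_eq_refl|].
      intros x Hx; exists n; intros y Hy H; apply Hx; intros z Hz.
      apply H; apply agree_trans with x; [apply agree_sym|]; assumption.
    + intros x; split; [apply HA|].
      intros [n Hn]; apply Hn, agree_refl.
Qed.

Lemma Csig_mono e g A : ord_le e g -> Csig e A -> Csig g A.
Proof.
  intros Hle H; pose proof (Csig_ge1 _ _ H) as H1.
  destruct H as [e A _ HA|e A B Hl HB HA].
  - apply Csig_open_ge1; [exact (ord_le_trans _ _ _ H1 Hle)|exact HA].
  - apply Csig_union with B; [exact (ord_lt_le_trans _ _ _ Hl Hle)| |exact HA].
    intros n; destruct (HB n) as (e' & He' & HB'); exists e'; split; [|exact HB'].
    exact (ord_lt_le_trans _ _ _ He' Hle).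
Qed.

Lemma Csig_compl_lt e g A : ord_lt e g -> Csig e A -> Csig g (compl A).
Proof.
  intros Hlt H; apply Csig_union with (B := fun _ => compl A).
  - exact (ord_le_lt_trans _ _ _ (Csig_ge1 _ _ H) Hlt).
  - intros _; exists e; split; [exact Hlt|].
    rewrite compl_compl; exact H.
  - intros x; split; [exists 0%nat; assumption|intros [_ Hx]; exact Hx].
Qed.

Lemma Csig_preimage g A f : continuous_map f -> Csig g A -> Csig g (fun x => A (f x)).
Proof.
  intros Hf H; revert A H; induction g as [g IH] using (well_founded_ind ord_lt_wf).
  intros A H; destruct (ord1_eq_or_lt g (Csig_ge1 _ _ H)) as [He|Hl].
  - apply Csig_open; [exact He|].
    exact (copen_preimage f A Hf (Csig_inv_open _ _ H He)).
  - destruct (Csig_inv _ _ H Hl) as (B & e & HB & ->).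
    apply Csig_union with (B := fun n x => B n (f x)); [exact Hl| |tauto].
    intros n; exists (e n); split; [apply HB|].
    exact (IH (e n) (proj1 (HB n)) _ (proj2 (HB n))).
Qed.

Lemma Csig_cup g (A : nat -> cantor -> Prop) :
  (forall n, Csig g (A n)) -> Csig g (fun x => exists n, A n x).
Proof.
  intros H; destruct (ord1_eq_or_lt g (Csig_ge1 _ _ (H 0%nat))) as [He|Hl].
  - apply Csig_open; [exact He|]; intros x [n Hn].
    destruct (Csig_inv_open _ _ (H n) He x Hn) as [m Hm].
    exists m; intros y Hy; exists n; exact (Hm y Hy).
  - assert (HB : forall n, exists B : nat -> cantor -> Prop,
        (forall m, exists e, ord_lt e g /\ Csig e (compl (B m))) /\
        A n = (fun x => exists m, B m x)).
    { intros n; destruct (Csig_inv _ _ (H n) Hl) as (B & e & HB & HA).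
      exists B; split; [intros m; exists (e m); apply HB|exact HA]. }
    destruct (choice _ HB) as [B HB'].
    apply Csig_union with (B := fun n => B (fst (of_nat n)) (snd (of_nat n))); [exact Hl| |].
    + intros n; apply (proj1 (HB' _)).
    + intros x; split.
      * intros [n Hn]; rewrite (proj2 (HB' n)) in Hn; destruct Hn as [m Hm].
        exists (to_nat (n, m)); rewrite cancel_of_to; exact Hm.
      * intros [n Hn]; exists (fst (of_nat n)).
        rewrite (proj2 (HB' _)); eexists; exact Hn.
Qed.

Lemma Csig_or g A B : Csig g A -> Csig g B -> Csig g (fun x => A x \/ B x).
Proof.
  intros HA HB.
  replace (fun x => A x \/ B x)
    with (fun x => exists n, (match n with O => A | _ => B end) x).
  - apply Csig_cup; intros [|n]; assumption.
  - apply pred_ext; intros x; split.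
    + intros [[|n] H]; [left|right]; exact H.
    + intros [H|H]; [exists 0%nat|exists 1%nat]; exact H.
Qed.

Lemma Csig_and g A B : Csig g A -> Csig g B -> Csig g (fun x => A x /\ B x).
Proof.
  intros HA HB; destruct (ord1_eq_or_lt g (Csig_ge1 _ _ HA)) as [He|Hl].
  - apply Csig_open; [exact He|]; intros x [Ha Hb].
    destruct (Csig_inv_open _ _ HA He x Ha) as [m Hm].
    destruct (Csig_inv_open _ _ HB He x Hb) as [n Hn].
    exists (max m n); intros y Hy; split; [apply Hm|apply Hn];
      apply agree_le with (2 := Hy); lia.
  - destruct (Csig_inv _ _ HA Hl) as (A' & e & HA' & ->).
    destruct (Csig_inv _ _ HB Hl) as (B' & e' & HB' & ->).
    apply Csig_union with
      (B := fun n x => A' (fst (of_nat n)) x /\ B' (snd (of_nat n)) x); [exact Hl| |].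
    + intros n; set (i := fst (of_nat n)); set (j := snd (of_nat n)).
      (* The complement of an intersection of two pieces is a union, which lives at the larger of
         the two levels. *)
      assert (Hm : exists m, ord_lt m g /\ ord_le (e i) m /\ ord_le (e' j) m).
      { destruct (ord_le_or_lt (e i) (e' j)) as [H|H].
        - exists (e' j); repeat split; [apply HB'|exact H|apply ord_le_refl].
        - exists (e i); repeat split; [apply HA'|apply ord_le_refl|apply ord_lt_le, H]. }
      destruct Hm as (m & Hm & H1 & H2); exists m; split; [exact Hm|].
      replace (compl (fun x => A' i x /\ B' j x))
        with (fun x => compl (A' i) x \/ compl (B' j) x)
        by (apply pred_ext; intros x; unfold compl; tauto).
      apply Csig_or; [apply Csig_mono with (1 := H1), HA'|apply Csig_mono with (1 := H2), HB'].
    + intros x; split.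
      * intros [[i Hi] [j Hj]]; exists (to_nat (i, j)); rewrite cancel_of_to; split; assumption.
      * intros [n [Hi Hj]]; split; eexists; eassumption.
Qed.

Lemma Csig_closed g A : ord_lt ord1 g -> copen (compl A) -> Csig g A.
Proof.
  intros Hl H; rewrite <- (compl_compl A).
  apply Csig_compl_lt with ord1; [exact Hl|].
  apply Csig_open; [apply ord1_eq_refl|exact H].
Qed.

Lemma Csig_empty g : ord_le ord1 g -> Csig g (fun _ => False).
Proof. intros Hg; apply Csig_open_ge1; [exact Hg|intros x []]. Qed.

(** A condition that does not mention the point leaves either [A] or the empty set. *)
Lemma Csig_guard g (Q : Prop) A : ord_le ord1 g -> (Q -> Csig g A) -> Csig g (fun x => Q /\ A x).
Proof.
  intros Hg H; destruct (classic Q) as [HQ|HQ].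
  - replace (fun x => Q /\ A x) with A by (apply pred_ext; tauto); exact (H HQ).
  - replace (fun x => Q /\ A x) with (fun _ : cantor => False) by (apply pred_ext; tauto).
    apply Csig_empty, Hg.
Qed.

(** * Enumerations of finite strings *)

Fixpoint nth_list {T : Type} (f : nat -> T) (k n : nat) : list T :=
  match k with
  | O => nil
  | S k' => f (fst (of_nat n)) :: nth_list f k' (snd (of_nat n))
  end.

Lemma list_enumeration {T : Type} (f : nat -> T) :
  (forall t, exists n, f n = t) -> exists d : nat -> list T, forall s, exists n, d n = s.
Proof.
  intros Hf; exists (fun n => nth_list f (fst (of_nat n)) (snd (of_nat n))); intros s.
  assert (H : exists n, nth_list f (length s) n = s).
  { induction s as [|t s [n Hn]]; [exists 0%nat; reflexivity|].
    destruct (Hf t) as [m Hm]; exists (to_nat (m, n)); cbn [length nth_list].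
    rewrite cancel_of_to; cbn [fst snd]; rewrite Hm, Hn; reflexivity. }
  destruct H as [n Hn]; exists (to_nat (length s, n)); rewrite cancel_of_to; exact Hn.
Qed.

Lemma string_enumeration : exists d : nat -> list bool, forall s, exists n, d n = s.
Proof.
  apply (list_enumeration (fun n => Nat.eqb n 0)).
  intros [|]; [exists 0%nat|exists 1%nat]; reflexivity.
Qed.

Definition string_of : nat -> list bool :=
  proj1_sig (constructive_indefinite_description _ string_enumeration).

Lemma string_of_surj s : exists n, string_of n = s.
Proof. exact (proj2_sig (constructive_indefinite_description _ string_enumeration) s). Qed.

(** [string_of] may repeat strings; [code] fixes one index for each. *)
Definition code (s : list bool) : nat :=
  proj1_sig (constructive_indefinite_description _ (string_of_surj s)).

Lemma string_of_code s : string_of (code s) = s.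
Proof. exact (proj2_sig (constructive_indefinite_description _ (string_of_surj s))). Qed.

(* The initial segment of length [n], latest entry first. *)
Fixpoint init {T : Type} (x : nat -> T) (n : nat) : list T :=
  match n with
  | O => nil
  | S n' => x n' :: init x n'
  end.

Lemma init_length {T} (x : nat -> T) n : length (init x n) = n.
Proof. induction n; simpl; congruence. Qed.

Lemma init_eq_agree {T} (x y : nat -> T) n : init x n = init y n <-> agree n x y.
Proof.
  induction n as [|n IH]; simpl.
  - split; [intros _ i Hi; lia|reflexivity].
  - split.
    + intros H; injection H as H1 H2; intros i Hi.
      destruct (Nat.eq_dec i n) as [->|Hne]; [exact H1|apply (proj1 IH H2); lia].
    + intros H; rewrite (H n) by lia; f_equal; apply IH; intros i Hi; apply H; lia.
Qed.

Definition is_init {T : Type} (s : list T) (x : nat -> T) : Prop := init x (length s) = s.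

Lemma is_init_agree {T} (s : list T) (x y : nat -> T) n :
  (length s <= n)%nat -> agree n x y -> is_init s x -> is_init s y.
Proof.
  intros Hn H Hx; unfold is_init in *; rewrite <- Hx at 2; symmetry; apply init_eq_agree.
  exact (agree_le _ _ _ _ Hn H).
Qed.

(** * Universal sets and the diagonal argument *)

Definition section_seq {T : Type} (y : nat -> T) (n k : nat) : T := y (to_nat (n, k)).

Lemma section_seq_continuous {T} n : continuous_map (fun y : nat -> T => section_seq y n).
Proof. exact (continuous_map_reindex (fun k => to_nat (n, k)) (fun b : T => b)). Qed.

(** Substituting pairs of continuous maps stands in for membership of [U] in the class on the
    product, so the hierarchy is kept to one space. The diagonal is the case of two identity
    maps. *)
Definition universal (g : ord) (U : cantor -> cantor -> Prop) : Prop :=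
  (forall f h, continuous_map f -> continuous_map h -> Csig g (fun x => U (f x) (h x))) /\
  forall A, Csig g A -> exists y, A = U y.

Definition decide (Q : Prop) : bool := if excluded_middle_informative Q then true else false.

Lemma decide_true Q : decide Q = true <-> Q.
Proof. unfold decide; destruct (excluded_middle_informative Q); split; congruence || tauto. Qed.

(** At the open level [y] lists basic open sets, and its section is their union. Above it, [y]
    splits into countably many codes of lower-level sets, and its section is the union of their
    complements. *)
Lemma universal_exists g : ord_le ord1 g -> exists U, universal g U.
Proof.
  induction g as [g IH] using (well_founded_ind ord_lt_wf); intros Hg.
  destruct (ord1_eq_or_lt g Hg) as [He|Hl].
  - exists (fun y x => exists n, y n = true /\ is_init (string_of n) x); split.
    + intros f h Hf Hh; apply Csig_open; [exact He|].
      intros x (n & Hn & Hi).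
      destruct (Hf x (S n)) as [m Hm], (Hh x (length (string_of n))) as [k Hk].
      exists (max m k); intros y Hy; exists n; split.
      * rewrite <- (Hm y); [exact Hn|apply agree_le with (2 := Hy); lia|lia].
      * apply (is_init_agree _ _ _ (length (string_of n)) (le_n _)) with (2 := Hi).
        apply Hk; apply agree_le with (2 := Hy); lia.
    + intros A HA; pose proof (Csig_inv_open _ _ HA He) as HO.
      exists (fun n => decide (forall x, is_init (string_of n) x -> A x)).
      apply pred_ext; intros x; split.
      * intros Hx; destruct (HO x Hx) as [n Hn]; exists (code (init x n)).
        rewrite string_of_code; unfold is_init; rewrite init_length; split; [|reflexivity].
        apply decide_true; intros y Hy; apply Hn, init_eq_agree; symmetry; exact Hy.
      * intros (n & Hn & Hi); rewrite decide_true in Hn; exact (Hn x Hi).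
  - destruct (ord_lt_cofinal_sequence g) as (h0 & Hh0 & Hcof).
    { exact (ord_le_lt_trans _ _ _ (ord_le_zero _) Hl). }
    assert (Hh : exists h : nat -> ord, (forall n, ord_lt (h n) g /\ ord_le ord1 (h n)) /\
      forall e, ord_lt e g -> exists n, ord_le e (h n)).
    (* Level zero contains no sets at all, so values below [ord1] are raised to [ord1]. *)
    { exists (fun n => if excluded_middle_informative (ord_le ord1 (h0 n)) then h0 n else ord1).
      split.
      - intros n; destruct (excluded_middle_informative _) as [H|H]; split; auto.
        apply ord_le_refl.
      - intros e He; destruct (Hcof e He) as [n Hn]; exists n.
        destruct (excluded_middle_informative _) as [H|H]; [exact Hn|].
        destruct (ord_le_or_lt ord1 (h0 n)) as [H'|H']; [tauto|].
        exact (ord_lt_le _ _ (ord_le_lt_trans _ _ _ Hn H')). }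
    clear h0 Hh0 Hcof; destruct Hh as (h & Hh & Hcof).
    destruct (choice (fun n U => universal (h n) U)) as [U HU].
    { intros n; apply IH; apply Hh. }
    (* Code number [n] is read at level [h (snd (of_nat n))]; the pairing makes each level available
       infinitely often. *)
    exists (fun y x => exists n, ~ U (snd (of_nat n)) (section_seq y n) x); split.
    + intros f k Hf Hk.
      apply Csig_union with (B := fun n x => ~ U (snd (of_nat n)) (section_seq (f x) n) (k x));
        [exact Hl| |tauto].
      intros n; exists (h (snd (of_nat n))); split; [apply Hh|].
      replace (compl _) with (fun x => U (snd (of_nat n)) (section_seq (f x) n) (k x)).
      * apply (proj1 (HU _)); [|exact Hk].
        exact (continuous_map_comp (fun y => section_seq y n) f (section_seq_continuous n) Hf).
      * apply pred_ext; intros x; unfold compl; split; [tauto|apply NNPP].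
    + intros A HA; destruct (Csig_inv _ _ HA Hl) as (B & e & HB & ->).
      (* Position (i, j) codes the complement of [B i] if level [h j] is high enough for it, and
         otherwise the whole space, whose complement adds nothing to the union. *)
      assert (Hc : forall n, exists c, forall x,
        U (snd (of_nat n)) c x <->
          (ord_le (e (fst (of_nat n))) (h (snd (of_nat n))) -> ~ B (fst (of_nat n)) x)).
      { intros n; set (i := fst (of_nat n)); set (j := snd (of_nat n)).
        destruct (classic (ord_le (e i) (h j))) as [H|H].
        - destruct (proj2 (HU j) (compl (B i))) as [c Hc].
          { apply Csig_mono with (1 := H), HB. }
          exists c; intros x; rewrite <- Hc; unfold compl; tauto.
        - destruct (proj2 (HU j) (fun _ => True)) as [c Hc].
          { apply Csig_open_ge1; [apply Hh|]; intros x _; exists 0%nat; trivial. }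
          exists c; intros x; rewrite <- Hc; tauto. }
      destruct (choice _ Hc) as [c Hc'].
      exists (fun m => c (fst (of_nat m)) (snd (of_nat m))).
      assert (Hs : forall n,
        section_seq (fun m => c (fst (of_nat m)) (snd (of_nat m))) n = c n).
      { intros n; apply functional_extensionality; intros k; unfold section_seq.
        rewrite cancel_of_to; reflexivity. }
      apply pred_ext; intros x; split.
      * intros [i Hi]; destruct (Hcof (e i)) as [j Hj]; [apply HB|].
        exists (to_nat (i, j)); rewrite Hs, Hc', cancel_of_to; cbn [fst snd]; tauto.
      * intros [n Hn]; rewrite Hs, Hc' in Hn; apply NNPP; intros Hx; apply Hn.
        intros _ Hb; apply Hx; eexists; exact Hb.
Qed.

(** Cantor's diagonal: a code of the complement of the diagonal set would belong to that set exactly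
    if it did not. *)
Lemma Csig_not_compl_exists g :
  ord_le ord1 g -> exists A, Csig g A /\ ~ Csig g (compl A).
Proof.
  intros Hg; destruct (universal_exists g Hg) as (U & HU & Hall).
  exists (fun x => U x x); split.
  - apply (HU (fun x => x) (fun x => x)); intros x n; exists n; auto.
  - intros H; destruct (Hall _ H) as [y Hy].
    pose proof (f_equal (fun P => P y) Hy) as E; cbv beta in E; unfold compl in E.
    assert (Hn : ~ U y y) by (intros Hu; assert (Hu' := Hu); rewrite <- E in Hu'; tauto).
    apply Hn; rewrite <- E; exact Hn.
Qed.

(** * Subgroups spanned by an independent set *)

Lemma decide_ext P Q : (P <-> Q) -> decide P = decide Q.
Proof. intros H; f_equal; apply propositional_extensionality, H. Qed.

Lemma decide_false Q : ~ Q -> decide Q = false.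
Proof. intros H; destruct (decide Q) eqn:E; [rewrite decide_true in E; tauto|reflexivity]. Qed.

Definition branch (x : cantor) : cantor := fun m => decide (is_init (string_of m) x).

Lemma branch_init x y n : branch x (code (init y n)) = decide (agree n x y).
Proof.
  apply decide_ext; rewrite string_of_code; unfold is_init; rewrite init_length.
  apply init_eq_agree.
Qed.

Lemma branch_succ x y n :
  branch x (code (true :: init y n)) = decide (agree n x y /\ x n = true).
Proof.
  apply decide_ext; rewrite string_of_code; unfold is_init; cbn [length init].
  rewrite init_length, <- init_eq_agree; split.
  - intros H; injection H as H1 H2; auto.
  - intros [H1 H2]; congruence.
Qed.

Lemma branch_continuous : continuous_map branch.
Proof.
  apply continuous_map_coordinates; intros x m; exists (length (string_of m)).
  intros y Hy; apply decide_ext; split; apply is_init_agree with (1 := le_n _); auto.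
  apply agree_sym, Hy.
Qed.

Definition xsum {T : Type} (F : T -> bool) (L : list T) : bool :=
  fold_right (fun t b => xorb (F t) b) false L.

Lemma xsum_app {T} (F : T -> bool) L M : xsum F (L ++ M) = xorb (xsum F L) (xsum F M).
Proof.
  induction L as [|t L IH]; simpl; [destruct (xsum F M); reflexivity|].
  rewrite IH; symmetry; apply xorb_assoc_reverse.
Qed.

Lemma xsum_false {T} (F : T -> bool) L : (forall t, In t L -> F t = false) -> xsum F L = false.
Proof.
  induction L as [|t L IH]; simpl; intros H; [reflexivity|].
  rewrite H, IH; auto.
Qed.

Lemma xsum_single {T} (F : T -> bool) L x :
  NoDup L -> In x L -> (forall y, In y L -> y <> x -> F y = false) -> xsum F L = F x.
Proof.
  intros HN Hx HF; destruct (in_split _ _ Hx) as (L1 & L2 & ->).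
  apply NoDup_remove in HN; destruct HN as [_ Hni].
  rewrite xsum_app; simpl; rewrite !xsum_false.
  - destruct (F x); reflexivity.
  - intros y Hy; apply HF; [apply in_or_app; simpl; auto|].
    intros ->; apply Hni, in_or_app; auto.
  - intros y Hy; apply HF; [apply in_or_app; simpl; auto|].
    intros ->; apply Hni, in_or_app; auto.
Qed.

Definition lsum (L : list cantor) : cantor := fun m => xsum (fun x => branch x m) L.

Definition span (A : cantor -> Prop) (z : cantor) : Prop :=
  exists L, Forall A L /\ z = lsum L.

Definition xadd (y z : cantor) : cantor := fun m => xorb (y m) (z m).

Definition xzero : cantor := fun _ => false.

Lemma span_zero A : span A xzero.
Proof. exists nil; split; [constructor|reflexivity]. Qed.

Lemma lsum_app L M : lsum (L ++ M) = xadd (lsum L) (lsum M).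
Proof. apply functional_extensionality; intros m; apply xsum_app. Qed.

Lemma span_add A y z : span A y -> span A z -> span A (xadd y z).
Proof.
  intros (L & HL & ->) (M & HM & ->); exists (L ++ M); split.
  - apply Forall_app; split; assumption.
  - symmetry; apply lsum_app.
Qed.

(** The number of occurrences of [x] modulo 2: the coordinate of [lsum L] at the vector
    [branch x]. *)
Definition coef (x : cantor) (L : list cantor) : bool := xsum (fun y => decide (y = x)) L.

(* The coefficient of [branch x] can be read off [lsum L], whence independence. *)
Lemma lsum_coef L x :
  exists n0, forall n, (n0 <= n)%nat -> lsum L (code (init x n)) = coef x L.
Proof.
  induction L as [|y L [n0 IH]]; [exists 0%nat; reflexivity|].
  assert (Hy : exists n1, forall n, (n1 <= n)%nat -> decide (agree n y x) = decide (y = x)).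
  { destruct (classic (y = x)) as [->|Hne].
    - exists 0%nat; intros n _; apply decide_ext; split; [reflexivity|].
      intros _; apply agree_refl.
    - assert (H : exists n, ~ agree n y x).
      { apply NNPP; intros H; apply Hne, agree_eq; intros n; apply NNPP; eauto. }
      destruct H as [n1 H1]; exists n1; intros n Hn; apply decide_ext; split; [|tauto].
      intros H; destruct H1; exact (agree_le _ _ _ _ Hn H). }
  destruct Hy as [n1 H1]; exists (max n0 n1); intros n Hn.
  unfold lsum, coef in *; simpl; rewrite branch_init, H1, IH by lia; reflexivity.
Qed.

Lemma coef_lsum_eq L M x : lsum L = lsum M -> coef x L = coef x M.
Proof.
  intros E; destruct (lsum_coef L x) as [m Hm], (lsum_coef M x) as [n Hn].
  rewrite <- (Hm (max m n)), <- (Hn (max m n)), E by lia; reflexivity.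
Qed.

Lemma coef_In x L : coef x L = true -> In x L.
Proof.
  intros H; apply NNPP; intros Hni; unfold coef in H; rewrite xsum_false in H; [discriminate|].
  intros y Hy; apply decide_false; intros ->; tauto.
Qed.

Lemma coef_NoDup x L : NoDup L -> In x L -> coef x L = true.
Proof.
  intros HN Hx; unfold coef; rewrite (xsum_single _ L x HN Hx); [apply decide_true; reflexivity|].
  intros y _ Hne; apply decide_false, Hne.
Qed.

Lemma span_branch A x : span A (branch x) <-> A x.
Proof.
  split.
  - intros (L & HL & E).
    assert (E' : lsum (x :: nil) = lsum L).
    { rewrite <- E; apply functional_extensionality; intros m; unfold lsum; simpl.
      apply xorb_false_r. }
    apply (proj1 (Forall_forall A L) HL), coef_In; rewrite <- (coef_lsum_eq _ _ x E').
    apply coef_NoDup; [repeat constructor; simpl; tauto|simpl; tauto].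
  - intros Hx; exists (x :: nil); split; [repeat constructor; exact Hx|].
    apply functional_extensionality; intros m; unfold lsum; simpl; symmetry; apply xorb_false_r.
Qed.

(** Two equal summands cancel modulo 2. Decoding works only with distinct summands. *)
Lemma lsum_reduce A L :
  Forall A L -> exists L', NoDup L' /\ Forall A L' /\ lsum L = lsum L'.
Proof.
  induction L as [|x L IH]; intros HL; [exists nil; repeat constructor|].
  inversion HL as [|x' L' Hx HL']; subst.
  destruct (IH HL') as (M & HN & HM & E).
  assert (E' : lsum (x :: L) = lsum (x :: M)).
  { apply functional_extensionality; intros m.
    change (xorb (branch x m) (lsum L m) = xorb (branch x m) (lsum M m)); rewrite E; reflexivity. }
  destruct (classic (In x M)) as [Hi|Hi].
  - destruct (in_split _ _ Hi) as (M1 & M2 & ->).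
    exists (M1 ++ M2); split; [apply NoDup_remove in HN; tauto|]; split.
    + apply Forall_app in HM; destruct HM as [H1 H2]; inversion H2; subst.
      apply Forall_app; split; assumption.
    + rewrite E'; apply functional_extensionality; intros m; unfold lsum; simpl.
      rewrite !xsum_app; simpl.
      destruct (branch x m), (xsum (fun y => branch y m) M1), (xsum (fun y => branch y m) M2);
        reflexivity.
  - exists (x :: M); repeat split; [constructor; assumption|constructor; assumption|exact E'].
Qed.

(** * Continuous decoding of the summands *)

Lemma NoDup_separated (L : list cantor) :
  exists N, forall x y, In x L -> In y L -> agree N x y -> x = y.
Proof.
  induction L as [|z L [N IH]]; [exists 0%nat; intros x y []|].
  assert (Hz : exists M, forall y, In y L -> agree M z y -> z = y).
  { clear; induction L as [|y L [M IH]]; [exists 0%nat; intros y []|].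
    destruct (classic (z = y)) as [->|Hne].
    - exists M; intros y' [->|Hy']; auto.
    - assert (H : exists n, ~ agree n z y).
      { apply NNPP; intros H; apply Hne, agree_eq; intros n; apply NNPP; eauto. }
      destruct H as [n Hn]; exists (max M n); intros y' [<-|Hy'] Ha.
      + destruct Hn; apply agree_le with (2 := Ha); lia.
      + apply IH; [exact Hy'|]; apply agree_le with (2 := Ha); lia. }
  destruct Hz as [M HM]; exists (max N M); intros x y [<-|Hx] [<-|Hy] Ha.
  - reflexivity.
  - apply HM; [exact Hy|]; apply agree_le with (2 := Ha); lia.
  - symmetry; apply HM; [exact Hx|]; apply agree_sym, agree_le with (2 := Ha); lia.
  - apply IH; [exact Hx|exact Hy|]; apply agree_le with (2 := Ha); lia.
Qed.

(* Starting from the string [s], follow the rightmost branch through nodes where [z] is nonzero. *)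
Fixpoint grow (z : cantor) (s : list bool) (n : nat) : list bool :=
  match n with
  | O => nil
  | S n' => (if Nat.ltb n' (length s) then nth n' s false else z (code (true :: grow z s n')))
              :: grow z s n'
  end.

(** The head of [grow z s (S n)] is its newest entry, the bit at position [n]. The result is the
    candidate for the summand of [z] that extends [s]. *)
Definition decode (z : cantor) (s : list bool) : cantor := fun n => hd false (grow z s (S n)).

Lemma decode_continuous s : continuous_map (fun z => decode z s).
Proof.
  assert (H : forall n z, exists k, forall z', agree k z z' -> grow z s n = grow z' s n).
  { intros n z; induction n as [|n [k IH]]; [exists 0%nat; reflexivity|].
    exists (max k (S (code (true :: grow z s n)))); intros z' Hz; cbn [grow].
    rewrite <- (IH z') by (apply agree_le with (2 := Hz); lia).
    rewrite <- (Hz (code (true :: grow z s n))) by lia; reflexivity. }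
  apply continuous_map_coordinates; intros z n; destruct (H (S n) z) as [k Hk].
  exists k; intros z' Hz; unfold decode; rewrite (Hk z' Hz); reflexivity.
Qed.

(** In natural order, unlike [init], because [grow] looks up its seed with [nth]. *)
Definition take (x : cantor) (n : nat) : list bool := map x (seq 0 n).

Lemma take_length x n : length (take x n) = n.
Proof. unfold take; rewrite length_map, length_seq; reflexivity. Qed.

Lemma nth_take x n i : (i < n)%nat -> nth i (take x n) false = x i.
Proof.
  intros Hi; unfold take.
  rewrite nth_indep with (d' := x 0%nat) by (rewrite length_map, length_seq; lia).
  rewrite map_nth, seq_nth by exact Hi; reflexivity.
Qed.

Lemma take_decode z s : take (decode z s) (length s) = s.
Proof.
  apply nth_ext with (d := false) (d' := false); rewrite take_length; [reflexivity|].
  intros i Hi; rewrite nth_take by exact Hi; unfold decode; cbn [grow hd].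
  apply Nat.ltb_lt in Hi; rewrite Hi; reflexivity.
Qed.

(** From length [N] on, no other summand passes through a prefix of [x], so [lsum L] at the right
    child of such a prefix is the next bit of [x]. *)
Lemma decode_lsum L N x :
  NoDup L -> (forall y, In y L -> agree N x y -> x = y) -> In x L ->
  decode (lsum L) (take x N) = x.
Proof.
  intros HN Hsep Hx.
  assert (H : forall n, grow (lsum L) (take x N) n = init x n).
  { induction n as [|n IH]; [reflexivity|]; cbn [grow init]; rewrite IH, take_length; f_equal.
    destruct (Nat.ltb_spec n N) as [Hlt|Hge]; [apply nth_take, Hlt|].
    unfold lsum; rewrite (xsum_single _ L x HN Hx).
    - rewrite branch_succ; destruct (x n) eqn:E; [|apply decide_false; intros [_ H]; congruence].
      apply decide_true; split; [apply agree_refl|reflexivity].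
    - intros y Hy Hne; rewrite branch_succ; apply decide_false; intros [Ha _].
      apply Hne; symmetry; apply Hsep; [exact Hy|].
      apply agree_sym, agree_le with (2 := Ha); exact Hge. }
  apply functional_extensionality; intros n; unfold decode; rewrite H; reflexivity.
Qed.

(** With one common length no string extends another, so the points decoded from them are
    distinct. *)
Definition good (p : list (list bool)) : Prop :=
  NoDup p /\ exists N, Forall (fun s => length s = N) p.

(** The closed condition certifying that [p] was a correct guess of the prefixes of the summands. *)
Definition fits (p : list (list bool)) (z : cantor) : Prop := z = lsum (map (decode z) p).

Lemma good_NoDup_decode p z : good p -> NoDup (map (decode z) p).
Proof.
  intros (HN & N & Hl); apply NoDup_map_inv with (f := fun x => take x N).
  rewrite map_map, map_ext_in with (g := fun s => s); [rewrite map_id; exact HN|].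
  intros s Hs; rewrite <- (proj1 (Forall_forall _ _) Hl s Hs); apply take_decode.
Qed.

(** The strings are prefixes of the summands, cut at a length that separates them. There are only
    countably many [p], and for each of them the summands depend continuously on [z]. *)
Lemma span_iff_fits A z :
  span A z <-> exists p, good p /\ fits p z /\ Forall (fun s => A (decode z s)) p.
Proof.
  split.
  - intros (L0 & HL0 & ->); destruct (lsum_reduce A L0 HL0) as (L & HN & HL & ->).
    destruct (NoDup_separated L) as [N Hsep].
    assert (E : map (decode (lsum L)) (map (fun x => take x N) L) = L).
    { rewrite map_map, map_ext_in with (g := fun x => x); [apply map_id|].
      intros x Hx; apply decode_lsum; auto. }
    exists (map (fun x => take x N) L); split; [split|split].
    + apply NoDup_map_inv with (f := decode (lsum L)); rewrite E; exact HN.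
    + exists N; apply Forall_map, Forall_forall; intros x _; apply take_length.
    + unfold fits; rewrite E; reflexivity.
    + apply Forall_map with (f := decode (lsum L)); rewrite E; exact HL.
  - intros (p & _ & Hf & HA); exists (map (decode z) p); split; [|exact Hf].
    apply Forall_map, HA.
Qed.

(** Independence makes the summands unique: once [z] fits a good [p], one decoded point outside [A]
    excludes [z] from the span. So the negation is again existential, apart from vectors that are no
    sum of branches. *)
Lemma not_span_iff_fits A z :
  ~ span A z <-> (forall p, good p -> ~ fits p z) \/
    exists p, good p /\ fits p z /\ Exists (fun s => ~ A (decode z s)) p.
Proof.
  split.
  - intros H; destruct (classic (exists p, good p /\ fits p z)) as [(p & Hg & Hf)|Hn].
    + right; exists p; split; [exact Hg|]; split; [exact Hf|].
      apply NNPP; intros HE; apply H, span_iff_fits; exists p; split; [exact Hg|].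
      split; [exact Hf|]; apply Forall_forall; intros s Hs; apply NNPP; intros Hs'.
      apply HE, Exists_exists; eauto.
    + left; intros p Hg Hf; apply Hn; eauto.
  - intros [H|(p & Hg & Hf & HE)] Hs.
    + apply span_iff_fits in Hs; destruct Hs as (p & Hg & Hf & _); exact (H p Hg Hf).
    + apply Exists_exists in HE; destruct HE as (s & Hs1 & Hs2).
      destruct Hs as (L & HL & E); apply Hs2.
      apply (proj1 (Forall_forall A L) HL), coef_In.
      rewrite <- (coef_lsum_eq (map (decode z) p) L) by (rewrite <- E; symmetry; exact Hf).
      apply coef_NoDup; [apply good_NoDup_decode, Hg|apply in_map, Hs1].
Qed.

Lemma fits_closed p : copen (compl (fits p)).
Proof.
  assert (HC : continuous_map (fun z => lsum (map (decode z) p))).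
  { induction p as [|s p IH].
    - intros x n; exists 0%nat; intros y _; apply agree_refl.
    - intros z n; destruct (IH z n) as [k Hk].
      destruct (continuous_map_comp branch _ branch_continuous (decode_continuous s) z n) as [m Hm].
      exists (max k m); intros z' Hz i Hi; unfold lsum; simpl; f_equal.
      + apply (Hm z'); [apply agree_le with (2 := Hz); lia|exact Hi].
      + apply (Hk z'); [apply agree_le with (2 := Hz); lia|exact Hi]. }
  intros z Hz.
  assert (H : exists n, ~ agree n z (lsum (map (decode z) p))).
  { apply NNPP; intros H; apply Hz, agree_eq; intros n; apply NNPP; eauto. }
  destruct H as [n Hn]; destruct (HC z n) as [m Hm].
  exists (max n m); intros z' Hz' Hf; apply Hn.
  apply agree_trans with z'; [apply agree_le with (2 := Hz'); lia|].
  rewrite Hf; apply agree_sym, Hm; apply agree_le with (2 := Hz'); lia.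
Qed.

Lemma string_list_enumeration : exists d : nat -> list (list bool), forall p, exists n, d n = p.
Proof. exact (list_enumeration string_of string_of_surj). Qed.

Lemma Csig_exists_fits g (Q : list (list bool) -> cantor -> Prop) :
  ord_lt ord1 g -> (forall p, Csig g (Q p)) ->
  Csig g (fun z => exists p, good p /\ fits p z /\ Q p z).
Proof.
  intros Hg HQ; destruct string_list_enumeration as [d Hd].
  replace (fun z => exists p, good p /\ fits p z /\ Q p z)
    with (fun z => exists n, good (d n) /\ fits (d n) z /\ Q (d n) z).
  - apply Csig_cup; intros n.
    apply (Csig_guard g (good (d n)) (fun z => fits (d n) z /\ Q (d n) z)); [apply ord_lt_le, Hg|].
    intros _; apply Csig_and; [|apply HQ].
    apply Csig_closed; [exact Hg|apply fits_closed].
  - apply pred_ext; intros z; split.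
    + intros [n Hn]; eauto.
    + intros (p & Hp); destruct (Hd p) as [n <-]; eauto.
Qed.

Lemma Csig_true g : ord_le ord1 g -> Csig g (fun _ => True).
Proof. intros Hg; apply Csig_open_ge1; [exact Hg|]; intros x _; exists 0%nat; trivial. Qed.

Lemma span_Csig g A : ord_lt ord1 g -> Csig g A -> Csig g (span A).
Proof.
  intros Hg HA; rewrite (pred_ext _ _ (span_iff_fits A)).
  apply (Csig_exists_fits g (fun p z => Forall (fun s => A (decode z s)) p) Hg).
  intros p; induction p as [|s p IH].
  - replace (fun z : cantor => Forall _ nil) with (fun _ : cantor => True).
    + apply Csig_true, ord_lt_le, Hg.
    + apply pred_ext; intros z; split; constructor.
  - replace (fun z => Forall (fun s0 => A (decode z s0)) (s :: p))
      with (fun z => A (decode z s) /\ Forall (fun s0 => A (decode z s0)) p)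
      by (apply pred_ext; intros z; symmetry; apply Forall_cons_iff).
    apply Csig_and; [|exact IH].
    apply (Csig_preimage g A (fun z => decode z s)); [apply decode_continuous|exact HA].
Qed.

Lemma span_compl_Csig g A : ord_lt ord2 g -> Csig g (compl A) -> Csig g (compl (span A)).
Proof.
  intros Hg HA.
  assert (H12 : ord_lt ord1 ord2) by apply ord_le_refl.
  assert (H1 : ord_lt ord1 g) by (apply ord_lt_le_trans with ord2; [|apply ord_lt_le]; assumption).
  unfold compl at 1; rewrite (pred_ext _ _ (not_span_iff_fits A)).
  apply Csig_or.
  - replace (fun z => forall p, good p -> ~ fits p z)
      with (compl (fun z => exists p, good p /\ fits p z /\ True)).
    (* Being a sum of branches is Sigma^0_2; its negation is covered once [g] exceeds 2. *)
    + apply Csig_compl_lt with ord2; [exact Hg|].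
      apply (Csig_exists_fits ord2 (fun _ _ => True) H12).
      intros _; apply Csig_true, ord_lt_le, H12.
    + apply pred_ext; intros z; unfold compl; split.
      * intros H p Hp Hf; apply H; eauto.
      * intros H (p & Hp & Hf & _); exact (H p Hp Hf).
  - apply (Csig_exists_fits g (fun p z => Exists (fun s => ~ A (decode z s)) p) H1).
    intros p; induction p as [|s p IH].
    + replace (fun z : cantor => Exists _ nil) with (fun _ : cantor => False).
      * apply Csig_empty, ord_lt_le, H1.
      * apply pred_ext; intros z; rewrite Exists_nil; tauto.
    + replace (fun z => Exists (fun s0 => ~ A (decode z s0)) (s :: p))
        with (fun z => compl A (decode z s) \/ Exists (fun s0 => ~ A (decode z s0)) p)
        by (apply pred_ext; intros z; symmetry; apply Exists_cons).
      apply Csig_or; [|exact IH].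
      apply (Csig_preimage g (compl A) (fun z => decode z s)); [apply decode_continuous|exact HA].
Qed.

(** * Winding numbers modulo 2 *)

Lemma dist2_euc p q : dist2 p q = dist_euc (fst p) (snd p) (fst q) (snd q).
Proof. unfold dist2, dist_euc; rewrite !Rsqr_pow2; reflexivity. Qed.

Lemma dist2_sym p q : dist2 p q = dist2 q p.
Proof. unfold dist2; f_equal; ring. Qed.

Lemma dist2_triangle p q r : dist2 p r <= dist2 p q + dist2 q r.
Proof. rewrite !dist2_euc; apply triangle. Qed.

Lemma dist2_refl p : dist2 p p = 0.
Proof. rewrite dist2_euc; apply distance_refl. Qed.

Lemma dist2_pos p q : 0 <= dist2 p q.
Proof. apply sqrt_pos. Qed.

Lemma dist2_fst p q : Rabs (fst p - fst q) <= dist2 p q.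
Proof.
  unfold dist2; rewrite <- sqrt_Rsqr_abs; apply sqrt_le_1_alt; rewrite Rsqr_pow2.
  pose proof (pow2_ge_0 (snd p - snd q)); lra.
Qed.

Lemma dist2_snd p q : Rabs (snd p - snd q) <= dist2 p q.
Proof.
  unfold dist2; rewrite <- sqrt_Rsqr_abs; apply sqrt_le_1_alt; rewrite Rsqr_pow2.
  pose proof (pow2_ge_0 (fst p - fst q)); lra.
Qed.

Lemma dist2_le_sum p q : dist2 p q <= Rabs (fst p - fst q) + Rabs (snd p - snd q).
Proof.
  unfold dist2; set (a := fst p - fst q); set (b := snd p - snd q).
  pose proof (Rabs_pos a); pose proof (Rabs_pos b).
  rewrite <- (sqrt_pow2 (Rabs a + Rabs b)) by lra; apply sqrt_le_1_alt.
  rewrite <- (pow2_abs a), <- (pow2_abs b); nra.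
Qed.

Lemma dist2_eq0 p q : dist2 p q = 0 -> p = q.
Proof.
  intros H; pose proof (dist2_fst p q) as H1; pose proof (dist2_snd p q) as H2.
  rewrite H in H1, H2; destruct p as [a b], q as [c d]; simpl in *.
  f_equal; revert H1 H2; unfold Rabs; repeat destruct Rcase_abs; lra.
Qed.

Lemma rad_pos n : 0 < rad n.
Proof. apply Rinv_0_lt_compat, lt_0_INR; lia. Qed.

Lemma rad_le m n : (m <= n)%nat -> rad n <= rad m.
Proof. intros H; apply Rinv_le_contravar; [apply lt_0_INR; lia|apply le_INR; lia]. Qed.

Lemma rad_le_half n : rad n <= / 2.
Proof.
  apply Rle_trans with (rad 0); [apply rad_le; lia|].
  unfold rad; simpl; lra.
Qed.

Lemma rad_diff n : rad n - rad (S n) = rad n * rad (S n).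
Proof.
  unfold rad; replace (S n + 2)%nat with (S (n + 2)) by lia; rewrite S_INR.
  assert (0 < INR (n + 2)) by (apply lt_0_INR; lia).
  field; split; lra.
Qed.

Lemma rad_archimedean eps : 0 < eps -> exists n, rad n < eps.
Proof.
  intros He; destruct (archimed_cor1 eps He) as (n & Hn & Hp); exists n.
  apply Rle_lt_trans with (2 := Hn); apply Rinv_le_contravar; [apply lt_0_INR, Hp|].
  apply le_INR; lia.
Qed.

(** By [rad_diff], a quarter of the gap between [rad n] and the next smaller radius. *)
Definition mesh (n : nat) : R := rad n * rad (S n) / 4.

Lemma mesh_pos n : 0 < mesh n.
Proof. unfold mesh; pose proof (rad_pos n); pose proof (rad_pos (S n)); nra. Qed.

Lemma mesh_le n : mesh n <= rad n / 8.
Proof.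
  unfold mesh; pose proof (rad_pos n); pose proof (rad_le_half (S n)); nra.
Qed.

(** Gaps between successive radii decrease, so the nearest other radius is the next smaller one. *)
Lemma rad_gap m n : m <> n -> rad m <= rad n - 4 * mesh n \/ rad n + 4 * mesh n <= rad m.
Proof.
  intros Hne; unfold mesh; destruct (Nat.lt_trichotomy m n) as [H|[H|H]]; [|tauto|].
  - right; destruct n as [|n]; [lia|].
    pose proof (rad_le m n ltac:(lia)); pose proof (rad_diff n); pose proof (rad_pos (S n)).
    pose proof (rad_le (S n) (S (S n)) ltac:(lia)); pose proof (rad_le n (S n) ltac:(lia)).
    assert (rad (S n) * rad (S (S n)) <= rad n * rad (S n)) by nra; lra.
  - left; pose proof (rad_le (S n) m ltac:(lia)); pose proof (rad_diff n); lra.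
Qed.

Lemma circle_equation r p :
  0 < r -> circle (0, r) r p <-> fst p ^ 2 + snd p ^ 2 = 2 * r * snd p.
Proof.
  intros Hr; unfold circle, dist2; simpl fst; simpl snd; split; intros H.
  - assert (H' : (fst p - 0) ^ 2 + (snd p - r) ^ 2 = r ^ 2).
    { rewrite <- (pow2_sqrt _ (Rplus_le_le_0_compat _ _ (pow2_ge_0 _) (pow2_ge_0 _))), H.
      reflexivity. }
    nra.
  - rewrite <- (sqrt_pow2 r) at 2 by lra; f_equal; nra.
Qed.

Lemma origin_on_circle n : circle (0, rad n) (rad n) origin.
Proof. apply circle_equation; [apply rad_pos|]; simpl; ring. Qed.

Lemma origin_Hawaiian : Hawaiian origin.
Proof. exists 0%nat; apply origin_on_circle. Qed.

Lemma circle_unique m n p :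
  circle (0, rad m) (rad m) p -> circle (0, rad n) (rad n) p -> m <> n -> p = origin.
Proof.
  rewrite !circle_equation by apply rad_pos; intros H1 H2 Hne.
  assert (Hd : rad m <> rad n).
  { destruct (rad_gap m n Hne); pose proof (mesh_pos n); lra. }
  assert (Hs : snd p = 0) by nra.
  assert (Hf : fst p = 0) by nra.
  destruct p; simpl in *; subst; reflexivity.
Qed.

(** * Crossings of the top of a circle *)

Definition upper (n : nat) (p : pt) : Prop := circle (0, rad n) (rad n) p /\ rad n < snd p.

(** Being close to [q], on the other side, [p] has abscissa below [mesh n] and hence lies close to
    the top. A point [s] near it on another circle would have the wrong height, since the radii
    differ by at least four meshes. *)
Lemma near_top n p q s :
  upper n p -> 0 <= fst p -> upper n q -> fst q < 0 -> Hawaiian s ->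
  dist2 p q < mesh n -> dist2 p s < mesh n -> upper n s.
Proof.
  intros [Hp Hp'] Hp0 _ Hq0 [m Hm] Hpq Hps.
  rewrite circle_equation in Hp by apply rad_pos.
  pose proof (mesh_pos n) as Hd; pose proof (mesh_le n) as Hd'.
  pose proof (dist2_fst p q) as H1; pose proof (dist2_fst p s) as H2.
  pose proof (dist2_snd p s) as H3.
  apply (Rle_lt_trans _ _ _ H1), Rabs_def2 in Hpq.
  assert (H2' := Rle_lt_trans _ _ _ H2 Hps); apply Rabs_def2 in H2'.
  assert (H3' := Rle_lt_trans _ _ _ H3 Hps); apply Rabs_def2 in H3'.
  pose proof (rad_gap m n) as Hgap.
  pose proof Hm as Hm'; rewrite circle_equation in Hm' by apply rad_pos.
  pose proof (rad_pos m) as Hrm; unfold upper; clear H1 H2 H3 Hps.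
  destruct p as [a b], q as [a' b'], s as [u v]; simpl fst in *; simpl snd in *.
  set (r := rad n) in *; set (d := mesh n) in *; set (t := rad m) in *.
  assert (Hr : 0 < r) by lra.
  assert (Ha : a < d) by lra.
  (* A lower point of the upper half has abscissa above [d] in absolute value, because [d] is at
     most [r / 8]. *)
  assert (Hb : 2 * r - d <= b).
  { destruct (Rle_or_lt (2 * r - d) b) as [H|H]; [exact H|exfalso]; nra. }
  assert (Hb' : b <= 2 * r) by nra.
  destruct (Nat.eq_dec m n) as [E|Hne].
  - split; [|lra]; unfold r; rewrite <- E; exact Hm.
  - exfalso; assert (Hu : - (2 * d) < u < 2 * d) by lra.
    assert (Hu2 : u ^ 2 < 4 * d ^ 2) by nra.
    destruct (Hgap Hne) as [H|H].
    + assert (t * v <= (r - 4 * d) * v) by nra; nra.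
    + assert ((r + 4 * d) * v <= t * v) by nra.
      assert (v * v < v * (2 * r + d)) by nra; nra.
Qed.

(** The top itself counts as right, so that right and left partition [upper n]. *)
Definition on_right (n : nat) (p : pt) : bool := decide (upper n p /\ 0 <= fst p).
Definition on_left (n : nat) (p : pt) : bool := decide (upper n p /\ fst p < 0).

Definition crossing (n : nat) (p q : pt) : bool :=
  (on_right n p && on_left n q) || (on_left n p && on_right n q).

Lemma crossing_sym n p q : crossing n p q = crossing n q p.
Proof.
  unfold crossing; destruct (on_right n p), (on_left n p), (on_right n q), (on_left n q);
    reflexivity.
Qed.

Lemma right_not_left n p : on_right n p = true -> on_left n p = false.
Proof.
  intros H; apply decide_false; unfold on_right in H; rewrite decide_true in H.
  intros [_ H']; lra.
Qed.

Lemma crossing_same n p : crossing n p p = false.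
Proof.
  unfold crossing; destruct (on_right n p) eqn:E; [rewrite (right_not_left _ _ E)|];
    destruct (on_left n p); reflexivity.
Qed.

(* On a set of small diameter the crossing cocycle is a coboundary. *)
Lemma crossing_coboundary n (B : pt -> Prop) :
  (forall p, B p -> Hawaiian p) ->
  (forall p q, B p -> B q -> dist2 p q < mesh n) ->
  exists u : pt -> bool, forall p q, B p -> B q -> crossing n p q = xorb (u p) (u q).
Proof.
  intros HE Hd.
  destruct (classic (exists p q, B p /\ B q /\ on_right n p = true /\ on_left n q = true))
    as [(p & q & Hp & Hq & Rp & Lq)|Hn].
  - unfold on_right in Rp; unfold on_left in Lq; rewrite decide_true in Rp, Lq.
    assert (HU : forall s, B s -> upper n s).
    { intros s Hs; apply (near_top n p q s); try tauto; auto. }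
    assert (HR : forall s, B s -> on_right n s = negb (on_left n s)).
    { intros s Hs; unfold on_right, on_left; pose proof (HU s Hs).
      destruct (Rle_or_lt 0 (fst s)) as [H0|H0].
      - rewrite (proj2 (decide_true _) (conj H H0)), decide_false; [reflexivity|lra].
      - rewrite (proj2 (decide_true _) (conj H H0)), decide_false; [reflexivity|lra]. }
    exists (on_left n); intros s t Hs Ht; unfold crossing; rewrite !HR by assumption.
    destruct (on_left n s), (on_left n t); reflexivity.
  - exists (fun _ => false); intros p q Hp Hq; unfold crossing.
    destruct (on_right n p) eqn:E1, (on_left n q) eqn:E2; try (exfalso; apply Hn; eauto 8; fail);
      destruct (on_left n p) eqn:E3, (on_right n q) eqn:E4; try reflexivity;
      exfalso; apply Hn; eauto 8.
Qed.

Fixpoint xorn (F : nat -> bool) (N : nat) : bool :=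
  match N with
  | O => false
  | S N' => xorb (xorn F N') (F N')
  end.

Lemma xorn_ext F G N : (forall i, (i < N)%nat -> F i = G i) -> xorn F N = xorn G N.
Proof.
  induction N as [|N IH]; simpl; intros H; [reflexivity|].
  rewrite IH, H by auto; reflexivity.
Qed.

Lemma xorn_add F a b : xorn F (a + b) = xorb (xorn F a) (xorn (fun j => F (a + j)%nat) b).
Proof.
  induction b as [|b IH].
  - rewrite Nat.add_0_r; simpl; symmetry; apply xorb_false_r.
  - rewrite Nat.add_succ_r; simpl; rewrite IH; apply xorb_assoc_reverse.
Qed.

Lemma xorn_mul F N M :
  xorn F (N * M) = xorn (fun i => xorn (fun j => F (i * M + j)%nat) M) N.
Proof.
  induction N as [|N IH]; [reflexivity|].
  replace (S N * M)%nat with (N * M + M)%nat by lia; rewrite xorn_add, IH; reflexivity.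
Qed.

Lemma xorn_telescope F (u : nat -> bool) N :
  (forall i, (i < N)%nat -> F i = xorb (u i) (u (S i))) -> xorn F N = xorb (u 0%nat) (u N).
Proof.
  induction N as [|N IH]; simpl; intros H; [destruct (u 0%nat); reflexivity|].
  rewrite IH, H by auto; destruct (u 0%nat), (u N), (u (S N)); reflexivity.
Qed.

Lemma xorn_rev F N : xorn F N = xorn (fun i => F (N - 1 - i)%nat) N.
Proof.
  induction N as [|N IH]; [reflexivity|].
  change (S N) with (1 + N)%nat at 3; rewrite xorn_add; cbn [xorn].
  replace (S N - 1 - 0)%nat with N by lia; rewrite IH, xorb_false_l, xorb_comm; f_equal.
  apply xorn_ext; intros i Hi; f_equal; lia.
Qed.

Definition sample (f : R -> pt) (N i : nat) : pt := f (INR i / INR N).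

Definition parity (n N : nat) (f : R -> pt) : bool :=
  xorn (fun i => crossing n (sample f N i) (sample f N (S i))) N.

(** Half a mesh leaves room for [parity_close], where a step along one path followed by a jump to
    the other must stay below one mesh. *)
Definition fine (n N : nat) (f : R -> pt) : Prop :=
  (0 < N)%nat /\ forall s s', 0 <= s <= 1 -> 0 <= s' <= 1 -> Rabs (s - s') <= / INR N ->
    dist2 (f s) (f s') < mesh n / 2.

Definition in_E (f : R -> pt) : Prop := forall s, 0 <= s <= 1 -> Hawaiian (f s).

Lemma fine_le n N M f : (N <= M)%nat -> fine n N f -> fine n M f.
Proof.
  intros Hle [HN H]; split; [lia|]; intros s s' Hs Hs' Hd; apply H; auto.
  apply Rle_trans with (1 := Hd), Rinv_le_contravar; [apply lt_0_INR, HN|apply le_INR, Hle].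
Qed.

Lemma ratio_bounds i N : (0 < N)%nat -> (i <= N)%nat -> 0 <= INR i / INR N <= 1.
Proof.
  intros HN Hi; assert (0 < INR N) by (apply lt_0_INR, HN).
  apply le_INR in Hi; pose proof (pos_INR i).
  split; [apply Rmult_le_pos; [lra|left; apply Rinv_0_lt_compat; lra]|].
  apply Rmult_le_reg_r with (INR N); [lra|]; unfold Rdiv.
  rewrite Rmult_assoc, Rinv_l; lra.
Qed.

Lemma ratio_succ i N : (0 < N)%nat -> INR (S i) / INR N = INR i / INR N + / INR N.
Proof.
  intros HN; assert (0 < INR N) by (apply lt_0_INR, HN); rewrite S_INR; field; lra.
Qed.

Lemma ratio_mul i N M : (0 < N)%nat -> (0 < M)%nat -> INR (i * M) / INR (N * M) = INR i / INR N.
Proof.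
  intros HN HM; rewrite !mult_INR; apply lt_0_INR in HN, HM; field; lra.
Qed.

(** Each coarse interval has an image of diameter below the mesh. Crossings are a coboundary there,
    and the sum over the subdivision telescopes to the two ends. *)
Lemma parity_refine n N M f :
  in_E f -> fine n N f -> (0 < M)%nat -> parity n (N * M) f = parity n N f.
Proof.
  intros HE [HN Hf] HM; unfold parity; rewrite xorn_mul; apply xorn_ext; intros i Hi.
  assert (HN' : 0 < / INR N) by (apply Rinv_0_lt_compat, lt_0_INR, HN).
  pose proof (ratio_succ i N HN) as HSi.
  pose proof (ratio_bounds i N HN ltac:(lia)) as Hb0.
  pose proof (ratio_bounds (S i) N HN ltac:(lia)) as Hb1.
  destruct (crossing_coboundary n
    (fun p => exists s, INR i / INR N <= s <= INR (S i) / INR N /\ p = f s)) as [u Hu].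
  - intros p (s & Hs & ->); apply HE; lra.
  - intros p q (s & Hs & ->) (s' & Hs' & ->).
    apply Rlt_trans with (mesh n / 2); [|pose proof (mesh_pos n); lra].
    apply Hf; [lra|lra|]; apply Rabs_le; lra.
  - assert (Hin : forall j, (j <= M)%nat ->
      INR i / INR N <= INR (i * M + j) / INR (N * M) <= INR (S i) / INR N).
    { intros j Hj; rewrite <- (ratio_mul i N M), <- (ratio_mul (S i) N M) by assumption.
      assert (0 < / INR (N * M)) by (apply Rinv_0_lt_compat, lt_0_INR; nia).
      split; apply Rmult_le_compat_r; try lra; apply le_INR; lia. }
    rewrite xorn_telescope with (u := fun j => u (sample f (N * M) (i * M + j))).
    + unfold sample; rewrite Nat.add_0_r.
      replace (i * M + M)%nat with (S i * M)%nat by lia.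
      rewrite !ratio_mul by assumption; symmetry; apply Hu.
      * exists (INR i / INR N); split; [lra|reflexivity].
      * exists (INR (S i) / INR N); split; [lra|reflexivity].
    + intros j Hj; replace (S (i * M + j)) with (i * M + S j)%nat by lia.
      apply Hu; eexists; (split; [apply Hin|reflexivity]); lia.
Qed.

Lemma parity_fine_eq n N M f : in_E f -> fine n N f -> fine n M f -> parity n N f = parity n M f.
Proof.
  intros HE HN HM; rewrite <- (parity_refine n N M f HE HN (proj1 HM)).
  rewrite Nat.mul_comm; apply parity_refine; [exact HE|exact HM|exact (proj1 HN)].
Qed.

(** A ladder argument: on the square made of one step of [f], the same step of [g] and two rungs,
    crossings are a coboundary. Hence the two counts differ by the first and the last rung, which
    are degenerate. *)
Lemma parity_close n N f g :
  in_E f -> in_E g -> fine n N f -> fine n N g ->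
  (forall s, 0 <= s <= 1 -> dist2 (f s) (g s) < mesh n / 2) ->
  f 0 = g 0 -> f 1 = g 1 -> parity n N f = parity n N g.
Proof.
  intros HEf HEg [HN Hf] [_ Hg] Hfg H0 H1.
  assert (E : xorb (parity n N f) (parity n N g) = false).
  { assert (HX : forall F G K, xorb (xorn F K) (xorn G K) = xorn (fun i => xorb (F i) (G i)) K).
    { intros F G K; induction K as [|K IH]; [reflexivity|]; simpl; rewrite <- IH.
      destruct (xorn F K), (xorn G K), (F K), (G K); reflexivity. }
    unfold parity; rewrite HX.
    rewrite xorn_telescope with (u := fun i => crossing n (sample f N i) (sample g N i)).
    - unfold sample; replace (INR 0 / INR N) with 0 by (simpl; unfold Rdiv; ring).
      assert (0 < INR N) by (apply lt_0_INR, HN).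
      replace (INR N / INR N) with 1 by (field; lra).
      rewrite H0, H1, !crossing_same; reflexivity.
    - intros i Hi; unfold sample.
      pose proof (ratio_succ i N HN) as HSi.
      pose proof (ratio_bounds i N HN ltac:(lia)) as Hb0.
      pose proof (ratio_bounds (S i) N HN ltac:(lia)) as Hb1.
      set (a := INR i / INR N) in *; set (b := INR (S i) / INR N) in *.
      assert (HN' : 0 < / INR N) by (apply Rinv_0_lt_compat, lt_0_INR, HN).
      assert (Hin : forall s s', s = a \/ s = b -> s' = a \/ s' = b ->
        0 <= s <= 1 /\ 0 <= s' <= 1 /\ Rabs (s - s') <= / INR N).
      { intros s s' [->| ->] [->| ->]; (repeat split; try lra); apply Rabs_le; lra. }
      destruct (crossing_coboundary n
        (fun p => exists s, (s = a \/ s = b) /\ (p = f s \/ p = g s))) as [u Hu].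
      + intros p (s & Hs & [->| ->]); [apply HEf|apply HEg]; destruct Hs as [->| ->]; lra.
      + pose proof (mesh_pos n) as Hm.
        intros p q (s & Hs & Hp) (s' & Hs' & Hq).
        destruct (Hin s s' Hs Hs') as (K1 & K2 & K3).
        specialize (Hf s s' K1 K2 K3); specialize (Hg s s' K1 K2 K3).
        pose proof (Hfg s K1) as F1.
        destruct Hp as [->| ->], Hq as [->| ->]; try lra.
        * pose proof (dist2_triangle (f s) (g s) (g s')); lra.
        * pose proof (dist2_triangle (g s) (f s) (f s')).
          rewrite (dist2_sym (g s) (f s)) in *; lra.
      + rewrite !Hu by eauto 8.
        destruct (u (f a)), (u (f b)), (u (g a)), (u (g b)); reflexivity. }
  destruct (parity n N f), (parity n N g); simpl in E; congruence.
Qed.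

(* Counts modulo 2 how often [f] crosses the topmost point of the [n]-th circle.  Every loop has a
   fine sampling, so [epsilon] is meaningful on loops. *)
Definition winding (f : R -> pt) : cantor :=
  fun n => parity n (epsilon (inhabits 0%nat) (fun N => fine n N f)) f.

Lemma winding_parity n N f : in_E f -> fine n N f -> winding f n = parity n N f.
Proof.
  intros HE HN; apply parity_fine_eq; [exact HE| |exact HN].
  apply (epsilon_spec (inhabits 0%nat) (fun N => fine n N f)); eauto.
Qed.

(** * Uniform continuity and homotopy invariance *)

Lemma clamp01_bounds s : 0 <= clamp01 s <= 1.
Proof. unfold clamp01, Rmax, Rmin; repeat destruct Rle_dec; lra. Qed.

Lemma clamp01_id s : 0 <= s <= 1 -> clamp01 s = s.
Proof. unfold clamp01, Rmax, Rmin; repeat destruct Rle_dec; lra. Qed.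

Lemma clamp01_le0 s : s <= 0 -> clamp01 s = 0.
Proof. unfold clamp01, Rmax, Rmin; repeat destruct Rle_dec; lra. Qed.

Lemma clamp01_ge1 s : 1 <= s -> clamp01 s = 1.
Proof. unfold clamp01, Rmax, Rmin; repeat destruct Rle_dec; lra. Qed.

Lemma clamp01_lipschitz s t : Rabs (clamp01 s - clamp01 t) <= Rabs (s - t).
Proof.
  unfold clamp01, Rmax, Rmin; repeat destruct Rle_dec; unfold Rabs; repeat destruct Rcase_abs; lra.
Qed.

Definition square_continuous (H : R -> R -> pt) : Prop :=
  forall s t eps, 0 < eps -> exists del, 0 < del /\
    forall s' t', 0 <= s <= 1 -> 0 <= t <= 1 -> 0 <= s' <= 1 -> 0 <= t' <= 1 ->
      Rabs (s - s') < del -> Rabs (t - t') < del -> dist2 (H s t) (H s' t') < eps.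

Lemma square_uniformly_continuous H eps :
  square_continuous H -> 0 < eps ->
  exists del, 0 < del /\
    forall s t s' t', 0 <= s <= 1 -> 0 <= t <= 1 -> 0 <= s' <= 1 -> 0 <= t' <= 1 ->
      Rabs (s - s') < del -> Rabs (t - t') < del -> dist2 (H s t) (H s' t') < eps.
Proof.
  intros HC He.
  assert (HK : forall pr : pt -> R, (forall p q, Rabs (pr p - pr q) <= dist2 p q) ->
    exists del, 0 < del /\
    forall s t s' t', 0 <= s <= 1 -> 0 <= t <= 1 -> 0 <= s' <= 1 -> 0 <= t' <= 1 ->
      Rabs (s - s') < del -> Rabs (t - t') < del ->
      Rabs (pr (H s t) - pr (H s' t')) < eps / 2).
  { intros pr Hpr.
    (* The planar theorem asks for continuity in full neighbourhoods of points of the square, hence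
       the clamping; it is applied to each coordinate of the plane separately. *)
    destruct (Continuity.uniform_continuity_2d
      (fun s t => pr (H (clamp01 s) (clamp01 t))) 0 1 0 1) with (eps := mkposreal (eps / 2) ltac:(lra))
      as [del Hdel].
    - intros s t Hs Ht e; destruct (HC s t e (cond_pos e)) as (d & Hd & Hd').
      exists (mkposreal d Hd); simpl; intros u v Hu Hv.
      apply Rle_lt_trans with (1 := Hpr _ _).
      rewrite dist2_sym, (clamp01_id s Hs), (clamp01_id t Ht).
      apply Hd'; auto using clamp01_bounds.
      + rewrite <- (clamp01_id s Hs); apply Rle_lt_trans with (1 := clamp01_lipschitz _ _).
        rewrite Rabs_minus_sym; exact Hu.
      + rewrite <- (clamp01_id t Ht); apply Rle_lt_trans with (1 := clamp01_lipschitz _ _).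
        rewrite Rabs_minus_sym; exact Hv.
    - exists del; split; [apply cond_pos|]; intros s t s' t' Hs Ht Hs' Ht' Hd1 Hd2.
      specialize (Hdel s' t' s t Hs' Ht' Hs Ht Hd1 Hd2); simpl in Hdel.
      rewrite !clamp01_id in Hdel by assumption; exact Hdel. }
  destruct (HK fst dist2_fst) as (d1 & Hd1 & K1), (HK snd dist2_snd) as (d2 & Hd2 & K2).
  exists (Rmin d1 d2); split; [apply Rmin_glb_lt; assumption|].
  intros s t s' t' Hs Ht Hs' Ht' H1 H2.
  pose proof (Rmin_l d1 d2); pose proof (Rmin_r d1 d2).
  apply Rle_lt_trans with (1 := dist2_le_sum _ _).
  specialize (K1 s t s' t' Hs Ht Hs' Ht'); specialize (K2 s t s' t' Hs Ht Hs' Ht').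
  apply Rlt_le_trans with (eps / 2 + eps / 2); [apply Rplus_lt_compat; [apply K1|apply K2]|]; lra.
Qed.

Lemma loop_uniformly_continuous l eps :
  is_loop l -> 0 < eps -> exists del, 0 < del /\
    forall s s', Rabs (s - s') < del -> dist2 (l s) (l s') < eps.
Proof.
  intros (Hcl & _ & Hc & _) He.
  destruct (square_uniformly_continuous (fun s _ => l s) eps) as (d & Hd & H); [|exact He|].
  - intros s t e Hep; destruct (Hc s e Hep) as (d & Hd & H); exists d; split; [exact Hd|].
    intros s' t' Hs _ Hs' _ H1 _; exact (H s' Hs Hs' H1).
  - exists d; split; [exact Hd|]; intros s s' Hss; rewrite (Hcl s), (Hcl s').
    apply (H _ 0 _ 0); try apply clamp01_bounds; try lra.
    + apply Rle_lt_trans with (1 := clamp01_lipschitz _ _), Hss.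
    + rewrite Rminus_diag, Rabs_R0; exact Hd.
Qed.

Lemma inv_INR_lt d : 0 < d -> exists N, (0 < N)%nat /\ / INR N < d.
Proof. intros H; destruct (archimed_cor1 d H) as (N & H1 & H2); eauto. Qed.

Lemma loop_fine n l : is_loop l -> exists N, fine n N l.
Proof.
  intros Hl; pose proof (mesh_pos n).
  destruct (loop_uniformly_continuous l (mesh n / 2) Hl) as (d & Hd & H'); [lra|].
  destruct (inv_INR_lt d Hd) as (N & HN & HNd); exists N; split; [exact HN|].
  intros s s' _ _ Hs; apply H'; lra.
Qed.

Lemma loop_in_E l : is_loop l -> in_E l.
Proof. intros (_ & H & _); exact H. Qed.

Lemma winding_close n f g :
  is_loop f -> is_loop g -> (forall s, 0 <= s <= 1 -> dist2 (f s) (g s) < mesh n / 2) ->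
  winding f n = winding g n.
Proof.
  intros Hf Hg Hd; destruct (loop_fine n f Hf) as [N HN], (loop_fine n g Hg) as [M HM].
  apply (fine_le n N (max N M)) in HN; [|lia]; apply (fine_le n M (max N M)) in HM; [|lia].
  rewrite (winding_parity n _ f (loop_in_E f Hf) HN), (winding_parity n _ g (loop_in_E g Hg) HM).
  destruct Hf as (_ & Ef & _ & F0 & F1), Hg as (_ & Eg & _ & G0 & G1).
  apply parity_close; auto; congruence.
Qed.

(** Consecutive stages of the homotopy are so close that [parity_close] applies. The same [N] counts
    the stages and the samples on each stage. *)
Lemma winding_homotopic f g :
  is_loop f -> is_loop g -> homotopic f g -> winding f = winding g.
Proof.
  intros Hf Hg (H & HE & HC & Hends & Hsides); apply functional_extensionality; intros n.
  pose proof (mesh_pos n).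
  destruct (square_uniformly_continuous H (mesh n / 2) HC) as (d & Hd & Hu); [lra|].
  destruct (inv_INR_lt d Hd) as (N0 & HN0 & HNd).
  destruct (loop_fine n f Hf) as [N1 H1], (loop_fine n g Hg) as [N2 H2].
  set (N := max N0 (max N1 N2)).
  assert (HN : / INR N < d).
  { apply Rle_lt_trans with (2 := HNd), Rinv_le_contravar; [apply lt_0_INR, HN0|].
    apply le_INR; lia. }
  assert (HNp : (0 < N)%nat) by lia.
  assert (HN' : 0 < / INR N) by (apply Rinv_0_lt_compat, lt_0_INR, HNp).
  assert (Hstage : forall j, (j <= N)%nat -> in_E (fun s => H s (INR j / INR N)) /\
    fine n N (fun s => H s (INR j / INR N))).
  { intros j Hj; pose proof (ratio_bounds j N HNp Hj); split.
    - intros s Hs; apply HE; assumption.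
    - split; [exact HNp|]; intros s s' Hs Hs' Hss; apply Hu; auto; [lra|].
      rewrite Rminus_diag, Rabs_R0; exact Hd. }
  assert (Hpar : forall j, (j <= N)%nat ->
    parity n N (fun s => H s (INR j / INR N)) = parity n N (fun s => H s (INR 0 / INR N))).
  { induction j as [|j IH]; intros Hj; [reflexivity|]; rewrite <- IH by lia.
    destruct (Hstage j) as [E1 F1]; [lia|]; destruct (Hstage (S j)) as [E2 F2]; [lia|].
    pose proof (ratio_bounds j N HNp ltac:(lia)) as B1.
    pose proof (ratio_bounds (S j) N HNp ltac:(lia)) as B2.
    apply parity_close; auto.
    - intros s Hs; apply Hu; auto.
      + rewrite Rminus_diag, Rabs_R0; exact Hd.
      + rewrite ratio_succ by exact HNp.
        replace (INR j / INR N + / INR N - INR j / INR N) with (/ INR N) by ring.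
        rewrite Rabs_pos_eq; lra.
    - rewrite (proj1 (Hsides _ B1)), (proj1 (Hsides _ B2)); reflexivity.
    - rewrite (proj2 (Hsides _ B1)), (proj2 (Hsides _ B2)); reflexivity. }
  (* [H] matches [f] and [g] on the unit interval only, but all samples lie there. *)
  assert (Hext : forall F t, (forall s, 0 <= s <= 1 -> H s t = F s) ->
    parity n N (fun s => H s t) = parity n N F).
  { intros F t HF; apply xorn_ext; intros i Hi; unfold sample.
    rewrite !HF by (apply ratio_bounds; lia); reflexivity. }
  rewrite (winding_parity n N f), (winding_parity n N g).
  - rewrite <- (Hext f 0), <- (Hext g 1) by (intros s Hs; apply Hends, Hs).
    specialize (Hpar N (le_n N)).
    assert (0 < INR N) by (apply lt_0_INR, HNp).
    replace (INR N / INR N) with 1 in Hpar by (field; lra).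
    replace (INR 0 / INR N) with 0 in Hpar by (simpl; unfold Rdiv; ring).
    symmetry; exact Hpar.
  - apply loop_in_E, Hg.
  - apply fine_le with (2 := H2); lia.
  - apply loop_in_E, Hf.
  - apply fine_le with (2 := H1); lia.
Qed.

(** * Loops with prescribed winding numbers *)

Lemma loop_le0 l s : is_loop l -> s <= 0 -> l s = origin.
Proof. intros (Hcl & _ & _ & H0 & _) Hs; rewrite Hcl, clamp01_le0; assumption. Qed.

Lemma loop_ge1 l s : is_loop l -> 1 <= s -> l s = origin.
Proof. intros (Hcl & _ & _ & _ & H1) Hs; rewrite Hcl, clamp01_ge1; assumption. Qed.

Lemma loop_Hawaiian l s : is_loop l -> Hawaiian (l s).
Proof. intros (Hcl & HE & _); rewrite Hcl; apply HE, clamp01_bounds. Qed.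

Lemma lconst_is_loop : is_loop lconst.
Proof.
  repeat split.
  - intros s _; apply origin_Hawaiian.
  - intros s eps He; exists 1; split; [lra|]; intros; unfold lconst; rewrite dist2_refl; exact He.
Qed.

Lemma lrev_is_loop f : is_loop f -> is_loop (lrev f).
Proof.
  intros Hf; unfold lrev; split; [|split; [|split; [|split]]].
  - intros s; destruct (Rle_or_lt s 0) as [H|H]; [|destruct (Rle_or_lt 1 s) as [H'|H']].
    + rewrite (clamp01_le0 s H), !(loop_ge1 f) by (assumption || lra); reflexivity.
    + rewrite (clamp01_ge1 s H'), !(loop_le0 f) by (assumption || lra); reflexivity.
    + rewrite clamp01_id by lra; reflexivity.
  - intros s _; apply loop_Hawaiian, Hf.
  - intros s eps He; destruct (loop_uniformly_continuous f eps Hf He) as (d & Hd & H).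
    exists d; split; [exact Hd|]; intros s' _ _ Hs; apply H.
    replace (1 - s - (1 - s')) with (- (s - s')) by ring; rewrite Rabs_Ropp; exact Hs.
  - apply loop_ge1; [exact Hf|lra].
  - apply loop_le0; [exact Hf|lra].
Qed.

Lemma lconcat_is_loop f g : is_loop f -> is_loop g -> is_loop (lconcat f g).
Proof.
  intros Hf Hg; unfold lconcat; split; [|split; [|split; [|split]]].
  - intros s; destruct (Rle_or_lt s 0) as [H|H]; [|destruct (Rle_or_lt 1 s) as [H'|H']].
    + rewrite (clamp01_le0 s H); repeat destruct Rle_dec; try lra.
      rewrite !(loop_le0 f) by (assumption || lra); reflexivity.
    + rewrite (clamp01_ge1 s H'); repeat destruct Rle_dec; try lra.
      rewrite !(loop_ge1 g) by (assumption || lra); reflexivity.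
    + rewrite clamp01_id by lra; reflexivity.
  - intros s _; destruct Rle_dec; apply loop_Hawaiian; assumption.
  - intros s eps He.
    destruct (loop_uniformly_continuous f (eps / 2) Hf) as (d1 & Hd1 & H1); [lra|].
    destruct (loop_uniformly_continuous g (eps / 2) Hg) as (d2 & Hd2 & H2); [lra|].
    pose proof (Rmin_l d1 d2); pose proof (Rmin_r d1 d2).
    exists (Rmin d1 d2 / 2); split; [assert (0 < Rmin d1 d2) by (apply Rmin_glb_lt; lra); lra|].
    intros s' _ _ Hs.
    assert (K1 : dist2 (f (2 * s)) (f (2 * s')) < eps / 2).
    { apply H1; replace (2 * s - 2 * s') with (2 * (s - s')) by ring.
      rewrite Rabs_mult, (Rabs_pos_eq 2) by lra; lra. }
    assert (K2 : dist2 (g (2 * s - 1)) (g (2 * s' - 1)) < eps / 2).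
    { apply H2; replace (2 * s - 1 - (2 * s' - 1)) with (2 * (s - s')) by ring.
      rewrite Rabs_mult, (Rabs_pos_eq 2) by lra; lra. }
    (* If [s] and [s'] straddle 1/2, both values are within [eps / 2] of the origin, where the two
       halves meet. *)
    destruct (Rle_dec s (1 / 2)) as [Ha|Ha], (Rle_dec s' (1 / 2)) as [Hb|Hb]; try lra.
    + rewrite (loop_ge1 f (2 * s')) in K1 by (assumption || lra).
      rewrite (loop_le0 g (2 * s - 1)) in K2 by (assumption || lra).
      pose proof (dist2_triangle (f (2 * s)) origin (g (2 * s' - 1))); lra.
    + rewrite (loop_ge1 f (2 * s)) in K1 by (assumption || lra).
      rewrite (loop_le0 g (2 * s' - 1)) in K2 by (assumption || lra).
      pose proof (dist2_triangle (g (2 * s - 1)) origin (f (2 * s'))); lra.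
  - destruct Rle_dec; [|lra]; apply loop_le0; [exact Hf|lra].
  - destruct Rle_dec; [lra|]; apply loop_ge1; [exact Hg|lra].
Qed.

Lemma winding_const : winding lconst = xzero.
Proof.
  apply functional_extensionality; intros n.
  destruct (loop_fine n _ lconst_is_loop) as [N HN].
  rewrite (winding_parity n N) by (apply loop_in_E, lconst_is_loop || exact HN).
  unfold parity, sample, lconst.
  rewrite xorn_telescope with (u := fun _ => false); [reflexivity|].
  intros i _; apply crossing_same.
Qed.

(** The same sample points are visited backwards and crossings are symmetric; the sign of an integer
    winding number is lost modulo 2. *)
Lemma winding_rev f : is_loop f -> winding (lrev f) = winding f.
Proof.
  intros Hf; apply functional_extensionality; intros n.
  destruct (loop_fine n _ Hf) as [N HN], (loop_fine n _ (lrev_is_loop f Hf)) as [M HM].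
  apply (fine_le n N (max N M)) in HN; [|lia]; apply (fine_le n M (max N M)) in HM; [|lia].
  set (K := max N M) in *; pose proof (proj1 HN) as HK.
  rewrite (winding_parity n K f), (winding_parity n K (lrev f));
    try assumption; [|apply loop_in_E, lrev_is_loop, Hf|apply loop_in_E, Hf].
  unfold parity; rewrite xorn_rev; apply xorn_ext; intros i Hi.
  assert (0 < INR K) by (apply lt_0_INR, HK).
  rewrite crossing_sym; unfold sample, lrev; f_equal; f_equal.
  - replace (S (K - 1 - i)) with (K - i)%nat by lia; rewrite minus_INR by lia; field; lra.
  - replace (K - 1 - i)%nat with (K - S i)%nat by lia; rewrite minus_INR by lia; field; lra.
Qed.

Lemma winding_concat f g :
  is_loop f -> is_loop g -> winding (lconcat f g) = xadd (winding f) (winding g).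
Proof.
  intros Hf Hg; apply functional_extensionality; intros n; unfold xadd.
  pose proof (lconcat_is_loop f g Hf Hg) as Hc.
  destruct (loop_fine n _ Hf) as [N1 H1], (loop_fine n _ Hg) as [N2 H2],
    (loop_fine n _ Hc) as [N3 H3].
  set (N := (N1 + N2 + N3)%nat).
  apply (fine_le n N1 N) in H1; [|lia]; apply (fine_le n N2 N) in H2; [|lia].
  apply (fine_le n N3 (N + N)) in H3; [|lia].
  rewrite (winding_parity n N f), (winding_parity n N g), (winding_parity n (N + N) (lconcat f g))
    by (assumption || (apply loop_in_E; assumption)).
  pose proof (proj1 H1) as HN; assert (HN' : 0 < INR N) by (apply lt_0_INR, HN).
  (* With [N + N] samples the midpoint is sampled, so the sampling splits into one of [f] and one of
     [g]. *)
  assert (E1 : forall i, (i <= N)%nat -> sample (lconcat f g) (N + N) i = sample f N i).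
  { intros i Hi; unfold sample, lconcat; rewrite plus_INR.
    pose proof (ratio_bounds i N HN Hi).
    replace (INR i / (INR N + INR N)) with (INR i / INR N / 2) by (field; lra).
    destruct Rle_dec; [f_equal; lra|lra]. }
  assert (E2 : forall j, (j <= N)%nat -> sample (lconcat f g) (N + N) (N + j) = sample g N j).
  { intros j Hj; unfold sample, lconcat; rewrite !plus_INR.
    pose proof (ratio_bounds j N HN Hj).
    replace ((INR N + INR j) / (INR N + INR N)) with (1 / 2 + INR j / INR N / 2) by (field; lra).
    (* Among these samples only time 1/2 falls under [f], and there both loops are at the origin. *)
    destruct Rle_dec.
    - rewrite (loop_ge1 f), (loop_le0 g) by (assumption || lra); reflexivity.
    - f_equal; lra. }
  unfold parity; rewrite xorn_add; f_equal; apply xorn_ext; intros i Hi.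
  - rewrite !E1 by lia; reflexivity.
  - rewrite <- Nat.add_succ_r, !E2 by lia; reflexivity.
Qed.

(** * A loop with a prescribed winding vector *)

Definition arc (n : nat) (t : R) : pt := (rad n * sin t, rad n - rad n * cos t).

Lemma arc_on_circle n t : circle (0, rad n) (rad n) (arc n t).
Proof.
  apply circle_equation; [apply rad_pos|]; unfold arc; simpl fst; simpl snd.
  pose proof (sin2_cos2 t) as H; rewrite !Rsqr_pow2 in H; nra.
Qed.

Lemma circle_dist_origin n p : circle (0, rad n) (rad n) p -> dist2 p origin <= 2 * rad n.
Proof.
  intros H; pose proof (dist2_triangle p (0, rad n) origin) as T.
  pose proof (origin_on_circle n) as H'; unfold circle in *.
  rewrite dist2_sym in H'; lra.
Qed.

Lemma arc_0 n : arc n 0 = origin.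
Proof. unfold arc; rewrite sin_0, cos_0; unfold origin; f_equal; ring. Qed.

Lemma arc_2PI n : arc n (2 * PI) = origin.
Proof. unfold arc; rewrite sin_2PI, cos_2PI; unfold origin; f_equal; ring. Qed.

Lemma arc_continuous n t eps :
  0 < eps -> exists del, 0 < del /\ forall t', Rabs (t - t') < del -> dist2 (arc n t) (arc n t') < eps.
Proof.
  intros He.
  assert (Hc : forall h, continuity h -> exists del, 0 < del /\
    forall t', Rabs (t - t') < del -> Rabs (h t - h t') < eps).
  { intros h Hh; destruct (Hh t eps He) as (d & Hd & H); exists d; split; [exact Hd|].
    intros t' Ht; destruct (Req_dec t t') as [<-|Hne]; [rewrite Rminus_diag, Rabs_R0; exact He|].
    rewrite Rabs_minus_sym; apply H; split; [split; [exact I|exact Hne]|].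
    simpl; unfold Rdist; rewrite Rabs_minus_sym; exact Ht. }
  destruct (Hc sin continuity_sin) as (d1 & Hd1 & H1), (Hc cos continuity_cos) as (d2 & Hd2 & H2).
  exists (Rmin d1 d2); split; [apply Rmin_glb_lt; assumption|]; intros t' Ht.
  pose proof (Rmin_l d1 d2); pose proof (Rmin_r d1 d2).
  specialize (H1 t' ltac:(lra)); specialize (H2 t' ltac:(lra)).
  apply Rle_lt_trans with (1 := dist2_le_sum _ _); unfold arc; simpl fst; simpl snd.
  replace (rad n * sin t - rad n * sin t') with (rad n * (sin t - sin t')) by ring.
  replace (rad n - rad n * cos t - (rad n - rad n * cos t'))
    with (rad n * (- (cos t - cos t'))) by ring.
  pose proof (rad_pos n); pose proof (rad_le_half n).
  rewrite !Rabs_mult, Rabs_Ropp, (Rabs_pos_eq (rad n)) by lra.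
  pose proof (Rabs_pos (sin t - sin t')); pose proof (Rabs_pos (cos t - cos t')); nra.
Qed.

Lemma arc_left n t : 0 <= t <= 2 * PI -> on_left n (arc n t) = true -> PI < t < 3 * (PI / 2).
Proof.
  intros Ht H; unfold on_left in H; rewrite decide_true in H; destruct H as [[_ H1] H2].
  unfold arc in *; simpl fst in *; simpl snd in *; pose proof (rad_pos n).
  assert (Hc : cos t < 0) by nra; assert (Hs : sin t < 0) by nra.
  pose proof PI_RGT_0; split.
  - apply Rnot_le_lt; intros H'; pose proof (sin_ge_0 t); lra.
  - apply Rnot_le_lt; intros H'.
    assert (0 <= cos (2 * PI - t)) by (apply cos_ge_0; lra).
    rewrite cos_minus, cos_2PI, sin_2PI in *; lra.
Qed.

Lemma arc_right n t : 0 <= t <= 2 * PI -> on_right n (arc n t) = true -> PI / 2 < t <= PI.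
Proof.
  intros Ht H; unfold on_right in H; rewrite decide_true in H; destruct H as [[_ H1] H2].
  unfold arc in *; simpl fst in *; simpl snd in *; pose proof (rad_pos n).
  assert (Hc : cos t < 0) by nra; assert (Hs : 0 <= sin t) by nra.
  pose proof PI_RGT_0; split.
  - apply Rnot_le_lt; intros H'; pose proof (cos_ge_0 t); lra.
  - apply Rnot_lt_le; intros H'; destruct (Rlt_or_le t (2 * PI)) as [H3|H3].
    + pose proof (sin_lt_0 t); lra.
    + replace t with (2 * PI) in Hc by lra; rewrite cos_2PI in Hc; lra.
Qed.

Lemma arc_right_intro n t : PI / 2 < t <= PI -> on_right n (arc n t) = true.
Proof.
  intros Ht; pose proof PI_RGT_0; pose proof (rad_pos n); apply decide_true.
  assert (cos t < 0) by (apply cos_lt_0; lra); assert (0 <= sin t) by (apply sin_ge_0; lra).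
  split; [split; [apply arc_on_circle|]|]; unfold arc; simpl; nra.
Qed.

Lemma arc_left_intro n t : PI < t < 3 * (PI / 2) -> on_left n (arc n t) = true.
Proof.
  intros Ht; pose proof PI_RGT_0; pose proof (rad_pos n); apply decide_true.
  assert (cos t < 0) by (apply cos_lt_0; lra); assert (sin t < 0) by (apply sin_lt_0; lra).
  split; [split; [apply arc_on_circle|]|]; unfold arc; simpl; nra.
Qed.

(** The arc starts at the lowest point, runs up the right side and reaches the top at PI. A step
    shorter than [PI / 2] across the top has both ends in the upper half, so the counter notices
    it. *)
Lemma crossing_arc n t t' :
  0 <= t <= 2 * PI -> 0 <= t' <= 2 * PI -> Rabs (t - t') < PI / 2 ->
  crossing n (arc n t) (arc n t') = xorb (decide (PI < t)) (decide (PI < t')).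
Proof.
  assert (W : forall t t', 0 <= t <= 2 * PI -> 0 <= t' <= 2 * PI -> Rabs (t - t') < PI / 2 ->
    t <= t' -> crossing n (arc n t) (arc n t') = xorb (decide (PI < t)) (decide (PI < t'))).
  { clear; intros t t' Ht Ht' Hd Hle; apply Rabs_def2 in Hd; unfold crossing.
    destruct (Rle_or_lt t PI) as [H|H].
    - rewrite (decide_false (PI < t)) by lra.
      destruct (Rle_or_lt t' PI) as [H'|H'].
      + rewrite (decide_false (PI < t')) by lra.
        destruct (on_left n (arc n t)) eqn:E1; [apply arc_left in E1; lra|].
        destruct (on_left n (arc n t')) eqn:E2; [apply arc_left in E2; lra|].
        destruct (on_right n (arc n t)); reflexivity.
      + rewrite (proj2 (decide_true (PI < t')) H'), arc_right_intro, arc_left_intro by lra.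
        reflexivity.
    - rewrite (proj2 (decide_true (PI < t)) H), (proj2 (decide_true (PI < t'))) by lra.
      destruct (on_right n (arc n t)) eqn:E1; [apply arc_right in E1; lra|].
      destruct (on_right n (arc n t')) eqn:E2; [apply arc_right in E2; lra|].
      destruct (on_left n (arc n t)); reflexivity. }
  intros Ht Ht' Hd; destruct (Rle_or_lt t t') as [H|H]; [apply W; assumption|].
  rewrite crossing_sym, xorb_comm; apply W; auto; [rewrite Rabs_minus_sym; exact Hd|lra].
Qed.

(* The [n]-th circle is traversed, if at all, during its own time interval [(rad (S n), rad n)]. *)
Definition stage (s : R) (n : nat) : Prop := rad (S n) < s < rad n.

Definition phase (n : nat) (s : R) : R := clamp01 ((s - rad (S n)) / (rad n - rad (S n))).

(** Defined for all times and resting at the origin outside its stage, so that each lap can be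
    compared with the whole tour. *)
Definition lap (y : cantor) (n : nat) (s : R) : pt :=
  if y n then arc n (2 * PI * phase n s) else origin.

Definition tour (y : cantor) (s : R) : pt :=
  match excluded_middle_informative (exists n, stage s n) with
  | left H => lap y (proj1_sig (constructive_indefinite_description _ H)) s
  | right _ => origin
  end.

Lemma stage_unique s m n : stage s m -> stage s n -> m = n.
Proof.
  intros [H1 H2] [H3 H4]; destruct (Nat.lt_trichotomy m n) as [H|[H|H]]; [|exact H|].
  - pose proof (rad_le (S m) n H); lra.
  - pose proof (rad_le (S n) m H); lra.
Qed.

Lemma rad_step_pos n : 0 < rad n - rad (S n).
Proof. rewrite rad_diff; pose proof (rad_pos n); pose proof (rad_pos (S n)); nra. Qed.

Lemma phase_le n s : s <= rad (S n) -> phase n s = 0.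
Proof.
  intros H; apply clamp01_le0; pose proof (rad_step_pos n).
  assert (0 < / (rad n - rad (S n))) by (apply Rinv_0_lt_compat; lra).
  unfold Rdiv; nra.
Qed.

Lemma phase_ge n s : rad n <= s -> phase n s = 1.
Proof.
  intros H; apply clamp01_ge1; pose proof (rad_step_pos n).
  apply Rmult_le_reg_r with (rad n - rad (S n)); [lra|].
  unfold Rdiv; rewrite Rmult_assoc, Rinv_l; lra.
Qed.

Lemma phase_lipschitz n s s' :
  Rabs (phase n s - phase n s') <= Rabs (s - s') / (rad n - rad (S n)).
Proof.
  apply Rle_trans with (1 := clamp01_lipschitz _ _); pose proof (rad_step_pos n).
  right; replace (_ - _) with ((s - s') / (rad n - rad (S n))) by (field; lra).
  unfold Rdiv; rewrite Rabs_mult, (Rabs_pos_eq (/ _)); [reflexivity|].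
  left; apply Rinv_0_lt_compat; lra.
Qed.

Lemma lap_off_stage y n s : ~ stage s n -> lap y n s = origin.
Proof.
  intros H; unfold lap; destruct (y n); [|reflexivity].
  destruct (Rle_or_lt s (rad (S n))) as [H1|H1].
  - rewrite phase_le, Rmult_0_r by exact H1; apply arc_0.
  - rewrite phase_ge, Rmult_1_r; [apply arc_2PI|].
    apply Rnot_lt_le; intros H2; apply H; split; assumption.
Qed.

Lemma lap_on_circle y n s : circle (0, rad n) (rad n) (lap y n s).
Proof. unfold lap; destruct (y n); [apply arc_on_circle|apply origin_on_circle]. Qed.

Lemma tour_lap y s : exists n, tour y s = lap y n s /\ forall z m, m <> n -> lap z m s = origin.
Proof.
  unfold tour; destruct (excluded_middle_informative _) as [H|H].
  - destruct (constructive_indefinite_description _ H) as [n Hn]; simpl; exists n.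
    split; [reflexivity|]; intros z m Hne; apply lap_off_stage; intros Hm.
    exact (Hne (stage_unique _ _ _ Hm Hn)).
  - exists 0%nat; split; [|intros z m _]; [symmetry|]; apply lap_off_stage; intros Hs; apply H; eauto.
Qed.

Lemma tour_Hawaiian y s : Hawaiian (tour y s).
Proof. destruct (tour_lap y s) as (n & -> & _); exists n; apply lap_on_circle. Qed.

Lemma tour_outside y s : s <= 0 \/ 1 <= s -> tour y s = origin.
Proof.
  intros Hs; destruct (tour_lap y s) as (n & -> & _); apply lap_off_stage; intros [H1 H2].
  pose proof (rad_pos (S n)); pose proof (rad_le_half n); lra.
Qed.

Lemma lap_dist_origin y n s : dist2 (lap y n s) origin <= 2 * rad n.
Proof. apply circle_dist_origin, lap_on_circle. Qed.

Lemma lap_continuous y n s eps :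
  0 < eps -> exists del, 0 < del /\
    forall s', Rabs (s - s') < del -> dist2 (lap y n s) (lap y n s') < eps.
Proof.
  intros He; unfold lap; destruct (y n).
  - destruct (arc_continuous n (2 * PI * phase n s) eps He) as (d & Hd & H).
    pose proof (rad_step_pos n) as Hr; pose proof PI_RGT_0.
    exists (d * (rad n - rad (S n)) / (2 * PI)); split.
    + apply Rdiv_lt_0_compat; nra.
    + intros s' Hs; apply H.
      replace (_ - _) with (2 * PI * (phase n s - phase n s')) by ring.
      rewrite Rabs_mult, (Rabs_pos_eq (2 * PI)) by lra.
      apply Rle_lt_trans with (2 * PI * (Rabs (s - s') / (rad n - rad (S n)))).
      * apply Rmult_le_compat_l; [lra|apply phase_lipschitz].
      * apply Rmult_lt_reg_r with ((rad n - rad (S n)) / (2 * PI)); [apply Rdiv_lt_0_compat; lra|].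
        replace (2 * PI * _ * _) with (Rabs (s - s')) by (field; lra).
        unfold Rdiv in *; lra.
  - exists 1; split; [lra|]; intros; rewrite dist2_refl; exact He.
Qed.

(** Lap [n] stays within [2 * rad n] of the origin, so only finitely many laps can move by [eps] at
    all. *)
Lemma lap_equicontinuous y s eps :
  0 < eps -> exists del, 0 < del /\
    forall n s', Rabs (s - s') < del -> dist2 (lap y n s) (lap y n s') < eps.
Proof.
  intros He; destruct (rad_archimedean (eps / 4)) as [K HK]; [lra|].
  assert (Hfin : forall k, exists del, 0 < del /\ forall n s', (n < k)%nat ->
    Rabs (s - s') < del -> dist2 (lap y n s) (lap y n s') < eps).
  { induction k as [|k (d & Hd & IH)]; [exists 1; split; [lra|]; intros; lia|].
    destruct (lap_continuous y k s eps He) as (d' & Hd' & H).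
    exists (Rmin d d'); split; [apply Rmin_glb_lt; assumption|]; intros n s' Hn Hs.
    pose proof (Rmin_l d d'); pose proof (Rmin_r d d').
    destruct (Nat.eq_dec n k) as [->|Hne]; [apply H|apply IH]; lra || lia. }
  destruct (Hfin K) as (d & Hd & H); exists d; split; [exact Hd|]; intros n s' Hs.
  destruct (Nat.lt_ge_cases n K) as [Hn|Hn]; [apply H; assumption|].
  pose proof (rad_le K n Hn).
  pose proof (dist2_triangle (lap y n s) origin (lap y n s')) as T.
  pose proof (lap_dist_origin y n s); pose proof (lap_dist_origin y n s').
  rewrite (dist2_sym origin) in T; lra.
Qed.

Lemma tour_is_loop y : is_loop (tour y).
Proof.
  split; [|split; [|split; [|split]]].
  - intros s; destruct (Rle_or_lt s 0) as [H|H]; [|destruct (Rle_or_lt 1 s) as [H'|H']].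
    + rewrite clamp01_le0, !tour_outside by lra; reflexivity.
    + rewrite clamp01_ge1, !tour_outside by lra; reflexivity.
    + rewrite clamp01_id by lra; reflexivity.
  - intros s _; apply tour_Hawaiian.
  - intros s eps He; destruct (lap_equicontinuous y s (eps / 2)) as (d & Hd & H); [lra|].
    exists d; split; [exact Hd|]; intros s' _ _ Hs.
    destruct (tour_lap y s) as (n & -> & Hn), (tour_lap y s') as (m & -> & Hm).
    pose proof (H n s' Hs) as H1; pose proof (H m s' Hs) as H2.
    destruct (Nat.eq_dec m n) as [->|Hne]; [lra|].
    (* Each of the two laps rests at the origin at the other's time, so both positions are within
       [eps / 2] of the origin. *)
    rewrite (Hm y n) in H1 by auto; rewrite (Hn y m) in H2 by auto.
    pose proof (dist2_triangle (lap y n s) origin (lap y m s')); lra.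
  - apply tour_outside; lra.
  - apply tour_outside; lra.
Qed.

(** Circles with index below [n] are treated alike, and all others stay within [2 * rad n] of the
    origin. This yields continuity of the section [tour] in the sup metric. *)
Lemma tour_agree y z n s : agree n y z -> dist2 (tour y s) (tour z s) <= 4 * rad n.
Proof.
  intros Ha; destruct (tour_lap y s) as (k & -> & Hk), (tour_lap z s) as (m & -> & Hm).
  assert (E : forall i, dist2 (lap y i s) (lap z i s) <= 4 * rad n).
  { intros i; destruct (Nat.lt_ge_cases i n) as [Hi|Hi].
    - unfold lap; rewrite (Ha i Hi), dist2_refl; pose proof (rad_pos n); lra.
    - pose proof (dist2_triangle (lap y i s) origin (lap z i s)) as T.
      pose proof (lap_dist_origin y i s); pose proof (lap_dist_origin z i s).
      pose proof (rad_le n i Hi); rewrite (dist2_sym origin) in T; lra. }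
  destruct (Nat.eq_dec m k) as [->|Hne]; [apply E|].
  specialize (E k); rewrite (Hm z k) in E by auto.
  rewrite (Hk z m) by exact Hne; exact E.
Qed.

Lemma origin_not_upper n : ~ upper n origin.
Proof. intros [_ H]; simpl in H; pose proof (rad_pos n); lra. Qed.

(** Distinct circles share only the origin, which is not in the upper half; so the counter of circle
    [n] sees lap [n] alone. *)
Lemma tour_upper y n s : upper n (tour y s) \/ upper n (lap y n s) -> tour y s = lap y n s.
Proof.
  destruct (tour_lap y s) as (k & E & Hk); destruct (Nat.eq_dec n k) as [->|Hne].
  - intros _; exact E.
  - rewrite (Hk y n Hne), E; intros [H|H].
    + assert (E' : lap y k s = origin).
      { apply (circle_unique k n); [apply lap_on_circle|apply H|auto]. }
      rewrite E' in H; destruct (origin_not_upper _ H).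
    + destruct (origin_not_upper _ H).
Qed.

Lemma crossing_tour y n s s' :
  crossing n (tour y s) (tour y s') = crossing n (lap y n s) (lap y n s').
Proof.
  assert (HR : forall t, on_right n (tour y t) = on_right n (lap y n t)).
  { intros t; apply decide_ext; split; intros [H1 H2].
    - rewrite <- (tour_upper y n t) by auto; auto.
    - rewrite (tour_upper y n t) by auto; auto. }
  assert (HL : forall t, on_left n (tour y t) = on_left n (lap y n t)).
  { intros t; apply decide_ext; split; intros [H1 H2].
    - rewrite <- (tour_upper y n t) by auto; auto.
    - rewrite (tour_upper y n t) by auto; auto. }
  unfold crossing; rewrite !HR, !HL; reflexivity.
Qed.

Lemma winding_tour y : winding (tour y) = y.
Proof.
  apply functional_extensionality; intros n; pose proof (tour_is_loop y) as HL.
  pose proof (rad_step_pos n) as Hr; pose proof PI_RGT_0 as HPI.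
  destruct (loop_fine n _ HL) as [N1 H1].
  (* Steps below a quarter of the stage turn the angle by less than [PI / 2], as [crossing_arc]
     requires. *)
  destruct (inv_INR_lt ((rad n - rad (S n)) / 4)) as (N2 & HN2 & H2); [lra|].
  set (N := max N1 N2); apply (fine_le n N1 N) in H1; [|lia].
  rewrite (winding_parity n N) by (apply loop_in_E, HL || exact H1).
  pose proof (proj1 H1) as HN.
  assert (HNs : / INR N < (rad n - rad (S n)) / 4).
  { apply Rle_lt_trans with (2 := H2), Rinv_le_contravar; [apply lt_0_INR, HN2|].
    apply le_INR; lia. }
  assert (HNp : 0 < INR N) by (apply lt_0_INR, HN).
  assert (HNi : 0 < / INR N) by (apply Rinv_0_lt_compat, HNp).
  unfold parity, sample.
  (* The potential tells whether lap [n], if present, is past the top; it goes from false to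
     [y n]. *)
  rewrite xorn_telescope
    with (u := fun i => y n && decide (PI < 2 * PI * phase n (INR i / INR N))).
  - rewrite phase_le, phase_ge.
    + rewrite (decide_false (PI < _ * 0)), (proj2 (decide_true (PI < _ * 1))) by lra.
      destruct (y n); reflexivity.
    + replace (INR N / INR N) with 1 by (field; lra); pose proof (rad_le_half n); lra.
    + unfold Rdiv; simpl; rewrite Rmult_0_l; left; apply rad_pos.
  - intros i _; rewrite crossing_tour; unfold lap; destruct (y n); cbn [andb]; [|apply crossing_same].
    pose proof (clamp01_bounds ((INR i / INR N - rad (S n)) / (rad n - rad (S n)))) as B1.
    pose proof (clamp01_bounds ((INR (S i) / INR N - rad (S n)) / (rad n - rad (S n)))) as B2.
    fold (phase n (INR i / INR N)) in B1; fold (phase n (INR (S i) / INR N)) in B2.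
    apply crossing_arc; [nra|nra|].
    replace (_ - _) with (2 * PI * (phase n (INR i / INR N) - phase n (INR (S i) / INR N))) by ring.
    rewrite Rabs_mult, (Rabs_pos_eq (2 * PI)) by lra.
    pose proof (phase_lipschitz n (INR i / INR N) (INR (S i) / INR N)) as Hp.
    rewrite ratio_succ in * by exact HN.
    replace (INR i / INR N - (INR i / INR N + / INR N)) with (- / INR N) in Hp by ring.
    rewrite Rabs_Ropp, (Rabs_pos_eq (/ INR N)) in Hp by lra.
    assert (/ INR N / (rad n - rad (S n)) < / 4).
    { apply Rmult_lt_reg_r with (rad n - rad (S n)); [exact Hr|].
      unfold Rdiv; rewrite Rmult_assoc, Rinv_l; lra. }
    nra.
Qed.

(** * Transfer to the loop space *)

Definition winding_preimage (H : cantor -> Prop) : Loop -> Prop := fun l => H (winding (lfun l)).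

(** The target group is abelian of exponent 2: a loop and its reverse have the same vector, and
    conjugation leaves the vector unchanged. *)
Lemma winding_preimage_normal H :
  H xzero -> (forall y z, H y -> H z -> H (xadd y z)) ->
  union_of_normal_subgroup (winding_preimage H).
Proof.
  intros H0 Hadd.
  assert (Hmem : forall f, is_loop f -> H (winding f) -> lmem (winding_preimage H) f).
  { intros f Hf HW; exists (exist _ f Hf); split; [reflexivity|exact HW]. }
  split; [split; [|split; [|split]]|].
  - intros [f Hf] [g Hg] Hh HS; unfold winding_preimage in *; simpl in *.
    rewrite <- (winding_homotopic f g Hf Hg Hh); exact HS.
  - apply Hmem; [apply lconst_is_loop|rewrite winding_const; exact H0].
  - intros [f Hf] [g Hg] HSf HSg; apply Hmem; [apply lconcat_is_loop; assumption|].
    simpl; rewrite winding_concat by assumption; apply Hadd; assumption.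
  - intros [f Hf] HSf; apply Hmem; [apply lrev_is_loop, Hf|].
    simpl; rewrite winding_rev by assumption; exact HSf.
  - intros [g Hg] [f Hf] HS; simpl; pose proof (lrev_is_loop g Hg) as Hr.
    pose proof (lconcat_is_loop _ _ Hr Hf) as Hc.
    apply Hmem; [apply lconcat_is_loop; assumption|].
    rewrite winding_concat, winding_concat, winding_rev by assumption.
    replace (xadd (xadd (winding g) (winding f)) (winding g)) with (winding f); [exact HS|].
    apply functional_extensionality; intros n; unfold xadd.
    destruct (winding g n), (winding f n); reflexivity.
Qed.

Lemma winding_continuous l n :
  exists eps, 0 < eps /\
    forall l', loop_dist_lt l l' eps -> agree n (winding (lfun l)) (winding (lfun l')).
Proof.
  induction n as [|n (e & He & IH)]; [exists 1; split; [lra|intros l' _ i Hi; lia]|].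
  pose proof (mesh_pos n); exists (Rmin e (mesh n / 2)); split; [apply Rmin_glb_lt; lra|].
  intros l' (d & Hd & Hl); pose proof (Rmin_l e (mesh n / 2)); pose proof (Rmin_r e (mesh n / 2)).
  intros i Hi; destruct (Nat.eq_dec i n) as [->|Hne].
  - apply winding_close; [apply (proj2_sig l)|apply (proj2_sig l')|].
    intros s Hs; specialize (Hl s Hs); lra.
  - apply (IH l'); [exists d; split; [lra|exact Hl]|lia].
Qed.

Lemma lopen_winding_preimage A : copen A -> lopen (winding_preimage A).
Proof.
  intros HA l Hl; destruct (HA _ Hl) as [n Hn].
  destruct (winding_continuous l n) as (e & He & H); exists e; split; [exact He|].
  intros l' Hl'; apply Hn, H, Hl'.
Qed.

Lemma Sigma0_winding_preimage g A : Csig g A -> Sigma0 g (winding_preimage A).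
Proof.
  revert A; induction g as [g IH] using (well_founded_ind ord_lt_wf); intros A H.
  destruct (ord1_eq_or_lt g (Csig_ge1 _ _ H)) as [He|Hl].
  - apply Sigma0_open; [exact He|].
    exact (lopen_winding_preimage _ (Csig_inv_open _ _ H He)).
  - destruct (Csig_inv _ _ H Hl) as (B & e & HB & ->).
    apply Sigma0_union with (B := fun n => winding_preimage (B n)); [exact Hl| |reflexivity].
    intros n; exists (e n); split; [apply HB|].
    exact (IH (e n) (proj1 (HB n)) _ (proj2 (HB n))).
Qed.

(** * Pulling subgroups of loops back to Cantor space *)

Definition loop_continuous (f : cantor -> Loop) : Prop :=
  forall x eps, 0 < eps -> exists n, forall y, agree n x y -> loop_dist_lt (f x) (f y) eps.

Lemma copen_loop_preimage f A : loop_continuous f -> lopen A -> copen (fun x => A (f x)).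
Proof.
  intros Hf HA x Hx; destruct (HA _ Hx) as (e & He & H).
  destruct (Hf x e He) as [n Hn]; exists n; intros y Hy; apply H, Hn, Hy.
Qed.

Lemma Csig_loop_preimage g S f :
  loop_continuous f -> Sigma0 g S -> Csig g (fun x => S (f x)).
Proof.
  intros Hf; revert S; induction g as [g IH] using (well_founded_ind ord_lt_wf); intros S H.
  destruct H as [g S He HS|g S B Hl HB HS].
  - apply Csig_open; [exact He|apply copen_loop_preimage; assumption].
  - apply Csig_union with (B := fun n x => B n (f x)); [exact Hl| |intros x; apply HS].
    intros n; destruct (HB n) as (e & He & HBn); exists e; split; [exact He|].
    exact (IH e He _ HBn).
Qed.

Definition tour_loop (y : cantor) : Loop := exist _ (tour y) (tour_is_loop y).

Lemma tour_loop_continuous : loop_continuous tour_loop.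
Proof.
  intros y eps He; destruct (rad_archimedean (eps / 4)) as [n Hn]; [lra|]; exists n.
  intros z Hz; exists (4 * rad n); split; [lra|]; intros s _; apply tour_agree, Hz.
Qed.

Lemma winding_preimage_tour H : (fun y => winding_preimage H (tour_loop y)) = H.
Proof.
  apply pred_ext; intros y; unfold winding_preimage; simpl; rewrite winding_tour; tauto.
Qed.

Definition branch_loop (x : cantor) : Loop := tour_loop (branch x).

Lemma branch_loop_continuous : loop_continuous branch_loop.
Proof.
  intros x eps He; destruct (tour_loop_continuous (branch x) eps He) as [n Hn].
  destruct (branch_continuous x n) as [m Hm]; exists m; intros y Hy; apply Hn, Hm, Hy.
Qed.

Definition span_loops (A : cantor -> Prop) : Loop -> Prop := winding_preimage (span A).

Lemma span_loops_normal A : union_of_normal_subgroup (span_loops A).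
Proof. apply winding_preimage_normal; [apply span_zero|apply span_add]. Qed.

Lemma span_loops_branch A : (fun x => span_loops A (branch_loop x)) = A.
Proof.
  apply pred_ext; intros x; unfold span_loops, winding_preimage; simpl.
  rewrite winding_tour; apply span_branch.
Qed.

Lemma Sigma0_span_loops_inv g A : Sigma0 g (span_loops A) -> Csig g A.
Proof.
  intros H; apply (Csig_loop_preimage _ _ branch_loop branch_loop_continuous) in H.
  rewrite span_loops_branch in H; exact H.
Qed.

Lemma Pi0_span_loops_inv g A : Pi0 g (span_loops A) -> Csig g (compl A).
Proof.
  intros H; apply (Csig_loop_preimage _ _ branch_loop branch_loop_continuous) in H.
  rewrite <- (span_loops_branch A); exact H.
Qed.

(** Not being Pi^0_g settles all negative clauses at once, since every lower class is contained in
    Pi^0_g. *)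
Lemma true_Sigma0_span_loops g A :
  ord_lt ord1 g -> Csig g A -> ~ Csig g (compl A) -> true_Sigma0 g (span_loops A).
Proof.
  intros Hg HA HnA.
  assert (HP : ~ Pi0 g (span_loops A)) by (intros H; apply HnA, Pi0_span_loops_inv, H).
  split; [apply Sigma0_winding_preimage, span_Csig; assumption|].
  split; [exact HP|]; split; [intros [_ H]; exact (HP H)|]; intros e He.
  assert (HP' : ~ Pi0 e (span_loops A)).
  { intros H; apply HnA, Csig_mono with e; [apply ord_lt_le, He|apply Pi0_span_loops_inv, H]. }
  split; [|split; [exact HP'|intros [_ H]; exact (HP' H)]].
  intros H; apply HnA, Csig_compl_lt with e; [exact He|apply Sigma0_span_loops_inv, H].
Qed.

Lemma true_Pi0_span_loops g A :
  ord_lt ord2 g -> Csig g (compl A) -> ~ Csig g A -> true_Pi0 g (span_loops A).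
Proof.
  intros Hg HA HnA.
  assert (HS : ~ Sigma0 g (span_loops A)) by (intros H; apply HnA, Sigma0_span_loops_inv, H).
  split; [apply (Sigma0_winding_preimage g (compl (span A))), span_compl_Csig; assumption|].
  split; [exact HS|]; split; [intros [H _]; exact (HS H)|]; intros e He.
  assert (HS' : ~ Sigma0 e (span_loops A)).
  { intros H; apply HnA, Csig_mono with e; [apply ord_lt_le, He|apply Sigma0_span_loops_inv, H]. }
  split; [exact HS'|split; [|intros [H _]; exact (HS' H)]].
  intros H; rewrite <- (compl_compl A) in HnA; apply HnA.
  apply Csig_compl_lt with e; [exact He|apply Pi0_span_loops_inv, H].
Qed.

Lemma Sigma0_ge1 g S : Sigma0 g S -> ord_le ord1 g.
Proof. intros [g' S' [_ H] _|g' S' B H _ _]; [exact H|apply ord_lt_le, H]. Qed.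

(** The zero vector is a closed point of Cantor space but not an open one, and there are no classes
    below the first. *)
Lemma true_Pi0_zero g :
  ord_eq g ord1 -> true_Pi0 g (winding_preimage (fun y => y = xzero)).
Proof.
  intros Hg.
  assert (HS : ~ Sigma0 g (winding_preimage (fun y => y = xzero))).
  { intros H; apply (Csig_loop_preimage _ _ tour_loop tour_loop_continuous) in H.
    rewrite (winding_preimage_tour (fun y => y = xzero)) in H.
    apply Csig_inv_open in H; [|exact Hg].
    destruct (H xzero eq_refl) as [n Hn].
    (* The vector whose only nonzero entry is at [n] agrees with zero before [n]. *)
    assert (E : (fun i => Nat.eqb i n) = xzero).
    { apply Hn; intros i Hi; symmetry; apply Nat.eqb_neq; lia. }
    apply (f_equal (fun y => y n)) in E; rewrite Nat.eqb_refl in E; discriminate. }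
  split; [|split; [exact HS|split; [intros [H _]; exact (HS H)|]]].
  - apply Sigma0_open; [exact Hg|].
    apply (lopen_winding_preimage (compl (fun y => y = xzero))).
    intros y Hy; assert (H : exists n, ~ agree n xzero y).
    { apply NNPP; intros H; apply Hy; symmetry; apply agree_eq; intros n; apply NNPP; eauto. }
    destruct H as [n Hn]; exists n; intros z Hz ->; apply Hn, agree_sym, Hz.
  - assert (Hlow : forall e S, ord_lt e g -> ~ Sigma0 e S).
    { intros e S He H; apply (ord_lt_irrefl e).
      apply ord_lt_le_trans with (1 := He), ord_le_trans with ord1; [apply Hg|].
      exact (Sigma0_ge1 _ _ H). }
    intros e He; split; [apply Hlow, He|split; [apply Hlow, He|]].
    intros [H _]; exact (Hlow e _ He H).
Qed.

Lemma true_Sigma0_exists g :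
  ord_le ord2 g -> exists S : Loop -> Prop, union_of_normal_subgroup S /\ true_Sigma0 g S.
Proof.
  intros Hg; destruct (Csig_not_compl_exists g) as (A & HA & HnA).
  (* [ord_le ord2 g] unfolds to [ord_lt ord1 g]. *)
  { apply ord_lt_le, Hg. }
  exists (span_loops A); split; [apply span_loops_normal|].
  apply true_Sigma0_span_loops; assumption.
Qed.

Lemma true_Pi0_exists g :
  ord_le ord1 g -> ~ ord_eq g ord2 ->
  exists S : Loop -> Prop, union_of_normal_subgroup S /\ true_Pi0 g S.
Proof.
  intros Hg Hne; destruct (ord1_eq_or_lt g Hg) as [He|Hl].
  - exists (winding_preimage (fun y => y = xzero)); split; [|apply true_Pi0_zero, He].
    apply winding_preimage_normal; [reflexivity|intros y z -> ->; reflexivity].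
  - destruct (ord_le_or_lt g ord2) as [H2|H2]; [exfalso; apply Hne; split; assumption|].
    destruct (Csig_not_compl_exists g Hg) as (A & HA & HnA).
    exists (span_loops (compl A)); split; [apply span_loops_normal|].
    apply true_Pi0_span_loops; [exact H2| |exact HnA].
    rewrite compl_compl; exact HA.
Qed.

(** * Analytic sets *)

Definition baire := nat -> nat.

Definition closed_rel (K : baire -> cantor -> Prop) : Prop :=
  forall w x, (forall n, exists w' x', agree n w w' /\ agree n x x' /\ K w' x') -> K w x.

Definition Sigma11 (A : cantor -> Prop) : Prop :=
  exists K, closed_rel K /\ forall x, A x <-> exists w, K w x.

(** [G] may also depend on the witness: in [Sigma11_span] the vector is shifted by a branch that the
    witness codes. *)
Lemma closed_rel_comp K (F : baire -> baire) (G : baire -> cantor -> cantor) :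
  closed_rel K -> continuous_map F ->
  (forall w x n, exists m, forall w' x',
     agree m w w' -> agree m x x' -> agree n (G w x) (G w' x')) ->
  closed_rel (fun w x => K (F w) (G w x)).
Proof.
  intros HK HF HG w x H; apply HK; intros n.
  destruct (HF w n) as [a Ha], (HG w x n) as [b Hb].
  destruct (H (max a b)) as (w' & x' & Hw & Hx & HKw); exists (F w'), (G w' x').
  split; [|split; [|exact HKw]].
  - apply Ha, agree_le with (2 := Hw); lia.
  - apply Hb; [apply agree_le with (2 := Hw)|apply agree_le with (2 := Hx)]; lia.
Qed.

Lemma closed_rel_and K M : closed_rel K -> closed_rel M -> closed_rel (fun w x => K w x /\ M w x).
Proof.
  intros HK HM w x H; split; [apply HK|apply HM]; intros n;
    destruct (H n) as (w' & x' & Hw & Hx & H1 & H2); eauto.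
Qed.

Lemma closed_rel_forall (K : nat -> baire -> cantor -> Prop) :
  (forall i, closed_rel (K i)) -> closed_rel (fun w x => forall i, K i w x).
Proof.
  intros HK w x H i; apply HK; intros n.
  destruct (H n) as (w' & x' & Hw & Hx & HKw); exists w', x'; auto.
Qed.

Lemma closed_rel_head (K : nat -> baire -> cantor -> Prop) :
  (forall i, closed_rel (K i)) -> closed_rel (fun w x => K (w 0%nat) w x).
Proof.
  intros HK w x H; apply HK; intros n.
  destruct (H (S n)) as (w' & x' & Hw & Hx & HKw); exists w', x'.
  rewrite (Hw 0%nat) by lia.
  split; [apply agree_le with (2 := Hw)|split; [apply agree_le with (2 := Hx)|exact HKw]]; lia.
Qed.

(** The first entry of the witness selects a member of the union. *)
Lemma Sigma11_union (A : nat -> cantor -> Prop) :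
  (forall n, Sigma11 (A n)) -> Sigma11 (fun x => exists n, A n x).
Proof.
  intros HA; destruct (choice _ HA) as [K HK].
  exists (fun w x => K (w 0%nat) (fun i => w (S i)) x); split.
  - apply (closed_rel_head (fun i w x => K i (fun j => w (S j)) x)); intros i.
    apply (closed_rel_comp (K i) (fun w j => w (S j)) (fun _ x => x)); [apply HK| |].
    + apply (continuous_map_reindex S (fun b : nat => b)).
    + intros w x n; exists n; auto.
  - intros x; split.
    + intros [n Hn]; apply HK in Hn; destruct Hn as [w Hw].
      exists (fun i => match i with O => n | S j => w j end); exact Hw.
    + intros [w Hw]; exists (w 0%nat); apply HK; eauto.
Qed.

(** The sections of one witness serve all members simultaneously. *)
Lemma Sigma11_inter (A : nat -> cantor -> Prop) :
  (forall n, Sigma11 (A n)) -> Sigma11 (fun x => forall n, A n x).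
Proof.
  intros HA; destruct (choice _ HA) as [K HK].
  exists (fun w x => forall n, K n (section_seq w n) x); split.
  - apply closed_rel_forall; intros i.
    apply (closed_rel_comp (K i) (fun w => section_seq w i) (fun _ x => x)); [apply HK| |].
    + apply section_seq_continuous.
    + intros w x n; exists n; auto.
  - intros x; split.
    + intros Hx; assert (HW : forall n, exists w, K n w x) by (intros n; apply HK, Hx).
      destruct (choice _ HW) as [w Hw].
      exists (fun m => w (fst (of_nat m)) (snd (of_nat m))); intros n.
      replace (section_seq _ n) with (w n); [apply Hw|].
      apply functional_extensionality; intros k; unfold section_seq; rewrite cancel_of_to.
      reflexivity.
    + intros [w Hw] n; apply HK; eauto.
Qed.

(** The witness supplies the length of a prefix whose neighbourhood lies in [A]. *)
Lemma Sigma11_open A : copen A -> Sigma11 A.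
Proof.
  intros HA; exists (fun w x => forall y, agree (w 0%nat) x y -> A y); split.
  - apply (closed_rel_head (fun i _ x => forall y, agree i x y -> A y)).
    intros i w x H y Hy; destruct (H i) as (w' & x' & _ & Hx & HK).
    apply HK, agree_trans with x; [apply agree_sym|]; assumption.
  - intros x; split.
    + intros Hx; destruct (HA x Hx) as [n Hn]; exists (fun _ => n); exact Hn.
    + intros [w Hw]; apply Hw, agree_refl.
Qed.

Lemma Sigma11_closed A : copen A -> Sigma11 (compl A).
Proof.
  intros HA; exists (fun _ x => ~ A x); split.
  - intros w x H Hx; destruct (HA x Hx) as [n Hn].
    destruct (H n) as (w' & x' & _ & Hx' & HK); exact (HK (Hn x' Hx')).
  - intros x; split; [intros Hx; exists (fun _ => 0%nat); exact Hx|intros [_ Hx]; exact Hx].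
Qed.

(** The easy half of Suslin's theorem. Carrying a set together with its complement turns the
    complement step into a swap. *)
Lemma Borel_preimage_Sigma11 S f :
  loop_continuous f -> Borel S -> Sigma11 (fun x => S (f x)) /\ Sigma11 (fun x => ~ S (f x)).
Proof.
  intros Hf; induction 1 as [S HS|S _ [IH1 IH2]|S B _ IH HS].
  - split; [apply Sigma11_open|apply (Sigma11_closed (fun x => S (f x)))];
      apply copen_loop_preimage; assumption.
  - split; [exact IH2|].
    replace (fun x => ~ lcompl S (f x)) with (fun x => S (f x)); [exact IH1|].
    apply pred_ext; intros x; unfold lcompl; split; [tauto|apply NNPP].
  - split.
    + replace (fun x => S (f x)) with (fun x => exists n, B n (f x))
        by (apply pred_ext; intros x; rewrite HS; tauto).
      apply (Sigma11_union (fun n x => B n (f x))); apply IH.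
    + replace (fun x => ~ S (f x)) with (fun x => forall n, ~ B n (f x)).
      * apply (Sigma11_inter (fun n x => ~ B n (f x))); apply IH.
      * apply pred_ext; intros x; rewrite HS; firstorder.
Qed.

Lemma nat_string_enumeration : exists d : nat -> list nat, forall s, exists n, d n = s.
Proof. apply (list_enumeration (fun n => n)); eauto. Qed.

(** A sequence [x] codes a union of boxes, whose complement is a closed relation; [A] asks whether
    the section of this relation at [x] itself is nonempty. *)
Lemma Sigma11_not_compl_exists : exists A, Sigma11 A /\ ~ Sigma11 (compl A).
Proof.
  destruct nat_string_enumeration as [d Hd].
  set (box := fun m (w : baire) (x : cantor) =>
    is_init (d (fst (of_nat m))) w /\ is_init (string_of (snd (of_nat m))) x).
  exists (fun x => exists w, forall m, x m = true -> ~ box m w x); split.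
  - exists (fun w x => forall m, x m = true -> ~ box m w x); split; [|tauto].
    apply closed_rel_forall; intros m w x H Hm [Hw Hx].
    destruct (H (S m + length (d (fst (of_nat m))) + length (string_of (snd (of_nat m))))%nat)
      as (w' & x' & Hw' & Hx' & HK).
    apply HK; [rewrite <- Hx' by lia; exact Hm|].
    split; [apply is_init_agree with (2 := Hw') (3 := Hw)|apply is_init_agree with (2 := Hx') (3 := Hx)];
      lia.
  - intros (K & HK & Hall).
    (* [y] marks the boxes that miss [K]. As [K] is closed, it is the complement of their union, and
       [Hall] fails at [y]. *)
    set (y := fun m => decide (forall w x, box m w x -> ~ K w x)).
    specialize (Hall y); unfold compl in Hall.
    assert (HE : (exists w, K w y) <-> exists w, forall m, y m = true -> ~ box m w y).
    { split; intros [w Hw]; exists w.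
      - intros m Hm Hb; unfold y in Hm; rewrite decide_true in Hm; exact (Hm w y Hb Hw).
      - apply HK; intros n; apply NNPP; intros Hn.
        destruct (Hd (init w n)) as [a Ha], (string_of_surj (init y n)) as [b Hb].
        apply (Hw (to_nat (a, b))).
        + apply decide_true; intros w' x'; unfold box, is_init; rewrite cancel_of_to.
          cbn [fst snd]; rewrite Ha, Hb, !init_length; intros [H1 H2] HK'; apply Hn.
          exists w', x'; repeat split; [| |exact HK']; apply init_eq_agree; symmetry; assumption.
        + unfold box, is_init; rewrite cancel_of_to; cbn [fst snd].
          rewrite Ha, Hb, !init_length; split; reflexivity. }
    tauto.
Qed.

(** Sums of exactly [k] branches, repetitions allowed. Analytic sets absorb the quantifier over [x],
    which here takes the place of decoding. *)
Fixpoint span_upto (A : cantor -> Prop) (k : nat) (z : cantor) : Prop :=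
  match k with
  | O => z = xzero
  | S k' => exists x, A x /\ span_upto A k' (xadd z (branch x))
  end.

Lemma xadd_self_inverse y z : xadd (xadd y z) z = y.
Proof.
  apply functional_extensionality; intros m; unfold xadd; destruct (y m), (z m); reflexivity.
Qed.

Lemma span_iff_upto A z : span A z <-> exists k, span_upto A k z.
Proof.
  assert (HC : forall x L, lsum (x :: L) = xadd (lsum L) (branch x)).
  { intros x L; apply functional_extensionality; intros m; apply xorb_comm. }
  split.
  - intros (L & HL & ->); exists (length L); induction HL as [|x L Hx HL IH]; [reflexivity|].
    exists x; split; [exact Hx|]; rewrite HC, xadd_self_inverse; exact IH.
  - intros [k Hk]; revert z Hk; induction k as [|k IH]; simpl; intros z Hz.
    + exists nil; split; [constructor|exact Hz].
    + destruct Hz as (x & Hx & Hz); destruct (IH _ Hz) as (L & HL & E).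
      exists (x :: L); split; [constructor; assumption|].
      rewrite HC, <- E; symmetry; apply xadd_self_inverse.
Qed.

Definition bits (w : baire) : cantor := fun i => Nat.eqb (w i) 0.

Lemma bits_surj x : exists w, bits w = x.
Proof.
  exists (fun i => if x i then 0%nat else 1%nat); apply functional_extensionality; intros i.
  unfold bits; destruct (x i); reflexivity.
Qed.

Lemma merge_sections (a b c : baire) :
  exists w, section_seq w 0 = a /\ section_seq w 1 = b /\ section_seq w 2 = c.
Proof.
  exists (fun m => match fst (of_nat m) with
                   | 0 => a (snd (of_nat m)) | 1 => b (snd (of_nat m)) | _ => c (snd (of_nat m))
                   end%nat).
  repeat split; apply functional_extensionality; intros i; unfold section_seq;
    rewrite cancel_of_to; reflexivity.
Qed.

Lemma Sigma11_span A : Sigma11 A -> Sigma11 (span A).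
Proof.
  intros (K & HK & HA); rewrite (pred_ext _ _ (span_iff_upto A)).
  apply Sigma11_union; induction n as [|k (M & HM & IH)].
  - replace (span_upto A 0) with (compl (fun z => z <> xzero)).
    + apply Sigma11_closed; intros z Hz.
      assert (H : exists n, ~ agree n z xzero).
      { apply NNPP; intros H; apply Hz, agree_eq; intros n; apply NNPP; eauto. }
      destruct H as [n Hn]; exists n; intros y Hy ->; exact (Hn Hy).
    + apply pred_ext; intros z; unfold compl; simpl; split; [apply NNPP|tauto].
  - set (pick := fun w : baire => bits (section_seq w 2)).
    assert (Hpick : continuous_map pick).
    { apply (continuous_map_reindex (fun j => to_nat (2, j)%nat) (fun a => Nat.eqb a 0)). }
    exists (fun w z => K (section_seq w 0) (pick w) /\
                       M (section_seq w 1) (xadd z (branch (pick w)))); split.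
    + apply closed_rel_and.
      * apply (closed_rel_comp K (fun w => section_seq w 0) (fun w _ => pick w)); [exact HK| |].
        -- apply section_seq_continuous.
        -- intros w x n; destruct (Hpick w n) as [m Hm]; exists m; auto.
      * apply (closed_rel_comp M (fun w => section_seq w 1) (fun w z => xadd z (branch (pick w))));
          [exact HM|apply section_seq_continuous|].
        intros w x n.
        destruct (continuous_map_comp branch pick branch_continuous Hpick w n) as [m Hm].
        exists (max n m); intros w' x' Hw Hx i Hi; unfold xadd; f_equal; [apply Hx; lia|].
        apply Hm; [apply agree_le with (2 := Hw); lia|exact Hi].
    + intros z; simpl; split.
      * intros (x & Hx & Hz); apply HA in Hx; apply IH in Hz.
        destruct Hx as [a Ha], Hz as [b Hb], (bits_surj x) as [c Hc].
        destruct (merge_sections a b c) as (w & E0 & E1 & E2); exists w.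
        unfold pick; rewrite E0, E1, E2, Hc; split; assumption.
      * intros (w & H1 & H2); exists (pick w); split; [apply HA|apply IH]; eauto.
Qed.

(** * Completeness of the loop space and approximation of loops *)

Lemma Hawaiian_closed p :
  (forall eps, 0 < eps -> exists q, Hawaiian q /\ dist2 q p <= eps) -> Hawaiian p.
Proof.
  intros H; apply NNPP; intros Hp.
  assert (Hr : 0 < dist2 p origin).
  { destruct (Rle_lt_or_eq_dec _ _ (dist2_pos p origin)) as [Hr|Hr]; [exact Hr|].
    symmetry in Hr; apply dist2_eq0 in Hr; rewrite Hr in Hp; destruct (Hp origin_Hawaiian). }
  (* Circles from index [K] on stay closer to the origin than half of the distance to [p]; the
     finitely many others each have positive distance from [p]. *)
  destruct (rad_archimedean (dist2 p origin / 4)) as [K HK]; [lra|].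
  assert (Hfin : forall k, exists eps, 0 < eps /\ forall n q, (n < k)%nat ->
    circle (0, rad n) (rad n) q -> eps < dist2 q p).
  { induction k as [|k (e & He & IH)]; [exists 1; split; [lra|intros; lia]|].
    set (g := Rabs (dist2 p (0, rad k) - rad k)).
    assert (Hg : 0 < g).
    { apply Rabs_pos_lt; intros E; apply Hp; exists k; apply Rminus_diag_uniq, E. }
    exists (Rmin e (g / 2)); split; [apply Rmin_glb_lt; lra|]; intros n q Hn Hq.
    pose proof (Rmin_l e (g / 2)); pose proof (Rmin_r e (g / 2)).
    destruct (Nat.eq_dec n k) as [->|Hne]; [|specialize (IH n q ltac:(lia) Hq); lra].
    apply Rle_lt_trans with (g / 2); [lra|]; apply Rlt_le_trans with g; [lra|].
    unfold circle in Hq; unfold g; pose proof (dist2_triangle p q (0, rad k)).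
    pose proof (dist2_triangle q p (0, rad k)); rewrite (dist2_sym p q) in *.
    apply Rabs_le; lra. }
  destruct (Hfin K) as (e & He & Hf).
  destruct (H (Rmin e (dist2 p origin / 4))) as (q & [n Hq] & Hd); [apply Rmin_glb_lt; lra|].
  pose proof (Rmin_l e (dist2 p origin / 4)); pose proof (Rmin_r e (dist2 p origin / 4)).
  destruct (Nat.lt_ge_cases n K) as [Hn|Hn]; [specialize (Hf n q Hn Hq); lra|].
  pose proof (circle_dist_origin n q Hq); pose proof (rad_le K n Hn).
  pose proof (dist2_triangle p q origin); rewrite (dist2_sym p q) in *; lra.
Qed.

Lemma dist2_zero_of_small p q : (forall eps, 0 < eps -> dist2 p q <= eps) -> p = q.
Proof.
  intros H; apply dist2_eq0, Rle_antisym; [|apply dist2_pos].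
  apply Rnot_lt_le; intros Hlt; specialize (H (dist2 p q / 2) ltac:(lra)); lra.
Qed.

Lemma plane_complete (u : nat -> pt) :
  (forall eps, 0 < eps -> exists N, forall m n, (N <= m)%nat -> (N <= n)%nat ->
     dist2 (u m) (u n) <= eps) ->
  exists p, forall eps, 0 < eps -> exists N, forall n, (N <= n)%nat -> dist2 (u n) p <= eps.
Proof.
  intros Hu.
  assert (HC : forall pr : pt -> R, (forall p q, Rabs (pr p - pr q) <= dist2 p q) ->
    exists a, Un_cv (fun n => pr (u n)) a).
  { intros pr Hpr; destruct (R_complete (fun n => pr (u n))) as [a Ha]; [|eauto].
    intros e He; destruct (Hu (e / 2)) as [N HN]; [lra|]; exists N; intros m n Hm Hn.
    specialize (HN m n Hm Hn); apply Rle_lt_trans with (1 := Hpr _ _); lra. }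
  destruct (HC fst dist2_fst) as [a Ha], (HC snd dist2_snd) as [b Hb]; exists (a, b).
  intros e He; destruct (Ha (e / 2)) as [N HN], (Hb (e / 2)) as [M HM]; try lra.
  exists (max N M); intros n Hn; apply Rle_trans with (1 := dist2_le_sum _ _).
  specialize (HN n ltac:(lia)); specialize (HM n ltac:(lia)); unfold Rdist in *; simpl; lra.
Qed.

Lemma loop_complete (L : nat -> Loop) :
  (forall eps, 0 < eps -> exists N, forall m n s, (N <= m)%nat -> (N <= n)%nat -> 0 <= s <= 1 ->
     dist2 (lfun (L m) s) (lfun (L n) s) <= eps) ->
  exists l : Loop, forall eps, 0 < eps -> exists N, forall n s, (N <= n)%nat -> 0 <= s <= 1 ->
     dist2 (lfun (L n) s) (lfun l s) <= eps.
Proof.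
  intros HL.
  destruct (choice (fun s p => forall eps, 0 < eps -> exists N, forall n, (N <= n)%nat ->
    dist2 (lfun (L n) (clamp01 s)) p <= eps)) as [l Hl].
  { intros s; apply plane_complete; intros e He; destruct (HL e He) as [N HN].
    exists N; intros m n Hm Hn; apply HN; auto using clamp01_bounds. }
  assert (HU : forall eps, 0 < eps -> exists N, forall n s, (N <= n)%nat -> 0 <= s <= 1 ->
     dist2 (lfun (L n) s) (l s) <= eps).
  { intros e He; destruct (HL (e / 2)) as [N HN]; [lra|]; exists N; intros n s Hn Hs.
    destruct (Hl s (e / 2)) as [M HM]; [lra|].
    specialize (HN n (max N M) s Hn ltac:(lia) Hs); specialize (HM (max N M) ltac:(lia)).
    rewrite clamp01_id in HM by exact Hs.
    pose proof (dist2_triangle (lfun (L n) s) (lfun (L (max N M)) s) (l s)); lra. }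
  assert (Hend : forall s, 0 <= s <= 1 -> (forall n, lfun (L n) s = origin) -> l s = origin).
  { intros s Hs H0; symmetry; apply dist2_zero_of_small; intros e He.
    destruct (HU e He) as [N HN]; rewrite <- (H0 N); apply HN; [lia|exact Hs]. }
  assert (Hloop : is_loop (fun s => l (clamp01 s))).
  { split; [|split; [|split; [|split]]].
    - intros s; rewrite (clamp01_id (clamp01 s)) by apply clamp01_bounds; reflexivity.
    - intros s _; apply Hawaiian_closed; intros e He; destruct (HU e He) as [N HN].
      exists (lfun (L N) (clamp01 s)); split; [apply loop_Hawaiian, (proj2_sig (L N))|].
      apply HN; [lia|apply clamp01_bounds].
    - intros s e He; destruct (HU (e / 4)) as [N HN]; [lra|].
      destruct (loop_uniformly_continuous (lfun (L N)) (e / 4) (proj2_sig (L N))) as (d & Hd & H);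
        [lra|].
      exists d; split; [exact Hd|]; intros s' Hs Hs' Hss; rewrite !clamp01_id by assumption.
      specialize (H s s' Hss).
      pose proof (HN N s (le_n N) Hs) as H1; pose proof (HN N s' (le_n N) Hs') as H2.
      pose proof (dist2_triangle (l s) (lfun (L N) s) (l s')).
      pose proof (dist2_triangle (lfun (L N) s) (lfun (L N) s') (l s')).
      pose proof (dist2_sym (l s) (lfun (L N) s)); lra.
    - rewrite clamp01_id by lra; apply Hend; [lra|]; intros n; apply (proj2_sig (L n)).
    - rewrite clamp01_id by lra; apply Hend; [lra|]; intros n; apply (proj2_sig (L n)). }
  exists (exist _ _ Hloop); simpl; intros e He; destruct (HU e He) as [N HN]; exists N.
  intros n s Hn Hs; rewrite clamp01_id by exact Hs; apply HN; assumption.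
Qed.

(** [analytic] asks for equality of loops as elements of [Loop], including their values outside the
    unit interval. *)
Lemma Loop_ext (l l' : Loop) :
  (forall s, 0 <= s <= 1 -> lfun l s = lfun l' s) -> l = l'.
Proof.
  destruct l as [f Hf], l' as [g Hg]; simpl; intros H.
  assert (E : f = g).
  { apply functional_extensionality; intros s.
    rewrite (proj1 Hf s), (proj1 Hg s); apply H, clamp01_bounds. }
  subst g; f_equal; apply proof_irrelevance.
Qed.

Definition nfloor (r : R) : nat := Z.to_nat (Int_part r).

Lemma nfloor_spec r : 0 <= r -> INR (nfloor r) <= r < INR (nfloor r) + 1.
Proof.
  intros Hr; destruct (base_Int_part r) as [H1 H2].
  assert (Hz : (0 <= Int_part r)%Z).
  { assert ((-1 < Int_part r)%Z) by (apply lt_IZR; lra); lia. }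
  unfold nfloor; rewrite INR_IZR_INZ, Z2Nat.id by exact Hz; lra.
Qed.

(* The shift by [(-1,-1)] lets natural numbers code all grid points near the Hawaiian earring. *)
Definition step (c : nat * list (nat * nat)) (s : R) : pt :=
  let N := INR (fst c) in
  let ab := nth (nfloor (s * N)) (snd c) (0, 0)%nat in
  (INR (fst ab) / N - 1, INR (snd ab) / N - 1).

Lemma grid_approximation x N :
  (0 < N)%nat -> -1 <= x -> Rabs (x - (INR (nfloor ((x + 1) * INR N)) / INR N - 1)) <= / INR N.
Proof.
  intros HN Hx; assert (0 < INR N) by (apply lt_0_INR, HN).
  destruct (nfloor_spec ((x + 1) * INR N)) as [H1 H2]; [nra|].
  set (a := INR (nfloor ((x + 1) * INR N))) in *.
  assert (E : x - (a / INR N - 1) = ((x + 1) * INR N - a) * / INR N) by (field; lra).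
  assert (Hi : 0 < / INR N) by (apply Rinv_0_lt_compat; lra).
  rewrite E, Rabs_pos_eq by nra; nra.
Qed.

(** The step functions need not be loops: coding a loop only takes a countable family that
    approximates every loop uniformly. *)
Lemma step_dense (l : Loop) eps :
  0 < eps -> exists c, forall s, 0 <= s <= 1 -> dist2 (lfun l s) (step c s) <= eps.
Proof.
  intros He; destruct l as [l Hl]; simpl.
  (* One third for the motion within a cell and one third for rounding each coordinate. *)
  destruct (loop_uniformly_continuous l (eps / 3) Hl) as (d & Hd & Hu); [lra|].
  destruct (inv_INR_lt (Rmin d (eps / 3))) as (N & HN & HNd); [apply Rmin_glb_lt; lra|].
  pose proof (Rmin_l d (eps / 3)); pose proof (Rmin_r d (eps / 3)).
  assert (HNp : 0 < INR N) by (apply lt_0_INR, HN).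
  assert (HNi : 0 < / INR N) by (apply Rinv_0_lt_compat, HNp).
  set (cell := fun i => (nfloor ((fst (l (INR i / INR N)) + 1) * INR N),
                         nfloor ((snd (l (INR i / INR N)) + 1) * INR N))).
  (* There are [S N] cells because time 1 falls into cell [N]. *)
  exists (N, map cell (seq 0 (S N))); intros s Hs; unfold step; cbn [fst snd].
  destruct (nfloor_spec (s * INR N)) as [H1 H2]; [nra|].
  set (i := nfloor (s * INR N)) in *.
  assert (Hi : (i < S N)%nat) by (apply INR_lt; rewrite S_INR; nra).
  rewrite nth_indep with (d' := cell 0%nat) by (rewrite length_map, length_seq; exact Hi).
  rewrite map_nth, seq_nth by exact Hi; rewrite Nat.add_0_l; unfold cell; cbn [fst snd].
  set (p := l (INR i / INR N)).
  assert (Hp : dist2 p origin <= 1).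
  { destruct (loop_Hawaiian l (INR i / INR N) Hl) as [n Hn]; fold p in Hn.
    pose proof (circle_dist_origin n p Hn); pose proof (rad_le_half n); lra. }
  pose proof (Rle_trans _ _ _ (dist2_fst p origin) Hp) as Hpx.
  pose proof (Rle_trans _ _ _ (dist2_snd p origin) Hp) as Hpy.
  simpl in Hpx, Hpy; rewrite Rminus_0_r in Hpx, Hpy.
  assert (Hx : -1 <= fst p) by (revert Hpx; unfold Rabs; destruct Rcase_abs; lra).
  assert (Hy : -1 <= snd p) by (revert Hpy; unfold Rabs; destruct Rcase_abs; lra).
  pose proof (grid_approximation (fst p) N HN Hx) as Gx.
  pose proof (grid_approximation (snd p) N HN Hy) as Gy.
  apply Rle_trans with (1 := dist2_triangle _ p _).
  assert (K1 : dist2 (l s) p < eps / 3).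
  { apply Hu; apply Rle_lt_trans with (/ INR N); [|lra].
    replace (s - INR i / INR N) with ((s * INR N - INR i) * / INR N) by (field; lra).
    rewrite Rabs_pos_eq by nra; nra. }
  eapply Rle_trans; [apply Rplus_le_compat_l, dist2_le_sum|]; cbn [fst snd]; lra.
Qed.

Lemma step_enumeration :
  exists q : nat -> R -> pt, forall (l : Loop) eps, 0 < eps ->
    exists c, forall s, 0 <= s <= 1 -> dist2 (lfun l s) (q c s) <= eps.
Proof.
  destruct (list_enumeration of_nat) as [d Hd].
  { intros p; exists (to_nat p); apply cancel_of_to. }
  exists (fun m => step (fst (of_nat m), d (snd (of_nat m)))); intros l eps He.
  destruct (step_dense l eps He) as [[N L] Hc]; destruct (Hd L) as [k <-].
  exists (to_nat (N, k)); rewrite cancel_of_to; exact Hc.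
Qed.

(** * Closed subsets of Baire space as Polish spaces *)

Lemma agree_first_difference (x y : baire) :
  x <> y -> exists n, agree n x y /\ x n <> y n.
Proof.
  intros Hne; apply NNPP; intros H; apply Hne, agree_eq; induction n as [|n IH].
  - intros i Hi; lia.
  - intros i Hi; destruct (Nat.eq_dec i n) as [->|Hi']; [|apply IH; lia].
    apply NNPP; intros Hd; apply H; eauto.
Qed.

Definition baire_dist (x y : baire) : R :=
  match excluded_middle_informative (x = y) with
  | left _ => 0
  | right H => / INR (S (proj1_sig (constructive_indefinite_description _
                                      (agree_first_difference x y H))))
  end.

Lemma inv_S_pos n : 0 < / INR (S n).
Proof. apply Rinv_0_lt_compat, lt_0_INR; lia. Qed.

Lemma inv_S_le m n : / INR (S m) <= / INR (S n) <-> (n <= m)%nat.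
Proof.
  split; intros H.
  - apply Nat.nlt_ge; intros Hlt; apply Rle_not_lt in H; apply H.
    apply Rinv_0_lt_contravar; [apply lt_0_INR; lia|apply lt_INR; lia].
  - apply Rinv_le_contravar; [apply lt_0_INR; lia|apply le_INR; lia].
Qed.

Lemma baire_dist_pos x y : 0 <= baire_dist x y.
Proof.
  unfold baire_dist; destruct (excluded_middle_informative _); [lra|left; apply inv_S_pos].
Qed.

(** Symmetry, the triangle inequality and limits are all reduced to [agree] through this
    equivalence. *)
Lemma baire_dist_agree x y n : baire_dist x y <= / INR (S n) <-> agree n x y.
Proof.
  unfold baire_dist; destruct (excluded_middle_informative _) as [->|H].
  - split; [intros _; apply agree_refl|intros _; left; apply inv_S_pos].
  - destruct (constructive_indefinite_description _ _) as (k & Hk & Hd); simpl proj1_sig.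
    rewrite inv_S_le; split; intros Hn; [apply agree_le with (2 := Hk), Hn|].
    apply Nat.nlt_ge; intros Hlt; apply Hd, Hn, Hlt.
Qed.

Lemma baire_dist_values x y : x = y \/ exists n, baire_dist x y = / INR (S n).
Proof.
  unfold baire_dist; destruct (excluded_middle_informative _) as [H|H]; [left; exact H|].
  right; eexists; reflexivity.
Qed.

Lemma baire_dist_refl x : baire_dist x x = 0.
Proof.
  unfold baire_dist; destruct (excluded_middle_informative _) as [H|H]; [|destruct H]; reflexivity.
Qed.

Lemma baire_dist_le_sym x y : baire_dist x y <= baire_dist y x.
Proof.
  destruct (baire_dist_values y x) as [->|[n Hn]]; [lra|].
  rewrite Hn; apply baire_dist_agree, agree_sym, baire_dist_agree; lra.
Qed.

Lemma baire_dist_triangle x y z : baire_dist x z <= baire_dist x y + baire_dist y z.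
Proof.
  pose proof (baire_dist_pos x y); pose proof (baire_dist_pos y z).
  destruct (baire_dist_values x y) as [->|[m Hm]]; [lra|].
  destruct (baire_dist_values y z) as [->|[n Hn]]; [lra|].
  apply Rle_trans with (/ INR (S (min m n))).
  - apply baire_dist_agree, agree_trans with y.
    + apply agree_le with m; [lia|apply baire_dist_agree; lra].
    + apply agree_le with n; [lia|apply baire_dist_agree; lra].
  - destruct (Nat.min_dec m n) as [E|E]; rewrite E; lra.
Qed.

Lemma inv_S_archimedean eps : 0 < eps -> exists n, / INR (S n) < eps.
Proof.
  intros He; destruct (inv_INR_lt eps He) as (n & Hn & H); exists n.
  apply Rle_lt_trans with (2 := H), Rinv_le_contravar; [apply lt_0_INR, Hn|apply le_INR; lia].
Qed.

Lemma baire_closed_polish (P : baire -> Prop) :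
  (exists x, P x) -> (forall x, (forall n, exists y, agree n x y /\ P y) -> P x) ->
  polish_metric {x : baire | P x} (fun x y => baire_dist (proj1_sig x) (proj1_sig y)).
Proof.
  intros [x0 Hx0] HP; split; [|split; [|split; [|split; [|split]]]].
  - intros x y; apply baire_dist_pos.
  - intros [x Hx] [y Hy]; simpl; split; intros H.
    + assert (E : x = y).
      { apply agree_eq; intros n; apply baire_dist_agree; rewrite H; left; apply inv_S_pos. }
      subst y; f_equal; apply proof_irrelevance.
    + injection H as ->; apply baire_dist_refl.
  - intros x y; apply Rle_antisym; apply baire_dist_le_sym.
  - intros x y z; apply baire_dist_triangle.
  - intros u Hu.
    assert (HN : forall k, exists N, forall m n, (N <= m)%nat -> (N <= n)%nat ->
      agree k (proj1_sig (u m)) (proj1_sig (u n))).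
    { intros k; destruct (Hu (/ INR (S k)) (inv_S_pos k)) as [N HN]; exists N.
      intros m n Hm Hn; apply baire_dist_agree; left; apply HN; assumption. }
    destruct (choice _ HN) as [N HN'].
    (* From index [N (S i)] on, coordinate [i] no longer changes. *)
    set (x := fun i => proj1_sig (u (N (S i))) i).
    assert (Hx : forall k m, (N k <= m)%nat -> agree k (proj1_sig (u m)) x).
    { intros k m Hm i Hi; transitivity (proj1_sig (u (max m (N (S i)))) i).
      - apply (HN' k); [exact Hm|lia|exact Hi].
      - apply (HN' (S i)); lia. }
    assert (HPx : P x).
    { apply HP; intros n; exists (proj1_sig (u (N n))); split; [|apply proj2_sig].
      apply agree_sym, Hx; lia. }
    exists (exist _ x HPx); simpl; intros e He; destruct (inv_S_archimedean e He) as [k Hk].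
    exists (N k); intros n Hn; apply Rle_lt_trans with (2 := Hk).
    apply baire_dist_agree, Hx, Hn.
  - destruct nat_string_enumeration as [d Hd].
    (* The dense sequence picks, for each string, a member of [P] extending it; [x0] fills the
       places where there is none. *)
    destruct (choice (fun n (y : {x : baire | P x}) =>
      (exists x, is_init (d n) x /\ P x) -> is_init (d n) (proj1_sig y))) as [D HD].
    { intros n; destruct (classic (exists x, is_init (d n) x /\ P x)) as [(x & Hx & HPx)|H].
      - exists (exist _ x HPx); auto.
      - exists (exist _ x0 Hx0); tauto. }
    exists D; intros [x Hx] e He; simpl; destruct (inv_S_archimedean e He) as [k Hk].
    destruct (Hd (init x k)) as [n Hn]; exists n; apply Rle_lt_trans with (2 := Hk).
    apply baire_dist_agree, init_eq_agree; symmetry.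
    specialize (HD n); unfold is_init in HD; rewrite Hn, init_length in HD; apply HD; eauto.
Qed.

(* A loop is coded by a sequence of step functions converging to it, paired with a witness [w]. *)
Lemma analytic_winding_preimage H :
  H xzero -> Sigma11 H -> analytic (winding_preimage H).
Proof.
  intros H0 (K & HK & HH); destruct step_enumeration as [q Hq].
  set (names := fun (x : baire) (l : Loop) =>
    (forall k s, 0 <= s <= 1 -> dist2 (lfun l s) (q (section_seq x 1 k) s) <= / INR (S k)) /\
    K (section_seq x 0) (winding (lfun l))).
  assert (Hclose : forall k x x' l l' s, section_seq x 1 k = section_seq x' 1 k ->
    names x l -> names x' l' -> 0 <= s <= 1 -> dist2 (lfun l s) (lfun l' s) <= 2 * / INR (S k)).
  { intros k x x' l l' s E [Hl _] [Hl' _] Hs.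
    specialize (Hl k s Hs); specialize (Hl' k s Hs); rewrite E in Hl.
    pose proof (dist2_triangle (lfun l s) (q (section_seq x' 1 k) s) (lfun l' s)).
    rewrite (dist2_sym (q (section_seq x' 1 k) s)) in *; lra. }
  assert (Hsmall : forall eps, 0 < eps -> exists k, 2 * / INR (S k) < eps).
  { intros e He; destruct (inv_S_archimedean (e / 2)) as [k Hk]; [lra|]; exists k; lra. }
  assert (Hsurj : forall l, H (winding (lfun l)) -> exists x, names x l).
  { intros l Hl; apply HH in Hl; destruct Hl as [w Hw].
    destruct (choice (fun k c => forall s, 0 <= s <= 1 ->
      dist2 (lfun l s) (q c s) <= / INR (S k))) as [c Hc].
    { intros k; apply Hq, inv_S_pos. }
    destruct (merge_sections w c c) as (x & E0 & E1 & _); exists x; unfold names.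
    rewrite E0, E1; split; assumption. }
  (* Loops named by better and better approximations of [x] eventually share each step function, so
     they form a Cauchy sequence; [x] names its limit. *)
  assert (Hclosed : forall x, (forall n, exists y, agree n x y /\ exists l, names y l) ->
    exists l, names x l).
  { intros x Hx.
    destruct (choice (fun n (yl : baire * Loop) => agree n x (fst yl) /\ names (fst yl) (snd yl)))
      as [yl Hyl].
    { intros n; destruct (Hx n) as (y & Hy & l & Hl); exists (y, l); split; assumption. }
    assert (Hsec : forall n i k, (to_nat (i, k) < n)%nat ->
      section_seq (fst (yl n)) i k = section_seq x i k).
    { intros n i k Hn; symmetry; apply (proj1 (Hyl n)), Hn. }
    destruct (loop_complete (fun n => snd (yl n))) as [l Hl].
    { intros e He; destruct (Hsmall e He) as [k Hk]; exists (S (to_nat (1, k)%nat)).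
      intros m n s Hm Hn Hs; left; apply Rle_lt_trans with (2 := Hk).
      apply Hclose with (fst (yl m)) (fst (yl n)); try apply Hyl; [|exact Hs].
      rewrite !Hsec by lia; reflexivity. }
    exists l; split.
    - intros k s Hs; apply Rnot_lt_le; intros Hlt.
      set (g := dist2 (lfun l s) (q (section_seq x 1 k) s) - / INR (S k)) in *.
      destruct (Hl (g / 2)) as [N HN]; [unfold g; lra|].
      set (n := max N (S (to_nat (1, k)%nat))).
      specialize (HN n s ltac:(lia) Hs).
      pose proof (proj1 (proj2 (Hyl n)) k s Hs) as Hn; rewrite Hsec in Hn by lia.
      pose proof (dist2_triangle (lfun l s) (lfun (snd (yl n)) s) (q (section_seq x 1 k) s)) as T.
      rewrite (dist2_sym (lfun l s) (lfun (snd (yl n)) s)) in T; unfold g in *; lra.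
    (* The witnesses and the winding vectors along the sequence agree with the limiting ones on ever
       longer prefixes, and [K] is closed. *)
    - apply HK; intros n; destruct (winding_continuous l n) as (e & He & Hc).
      destruct (Hl (e / 2)) as [N HN]; [lra|].
      destruct (section_seq_continuous 0 x n) as [m Hm].
      set (j := max N m).
      exists (section_seq (fst (yl j)) 0), (winding (lfun (snd (yl j)))).
      split; [|split; [|apply Hyl]].
      + apply Hm, agree_le with j; [lia|apply Hyl].
      + apply Hc; exists (e / 2); split; [lra|]; intros s Hs; rewrite dist2_sym.
        apply HN; [lia|exact Hs]. }
  set (P := fun x => exists l, names x l).
  exists {x : baire | P x}, (fun x y => baire_dist (proj1_sig x) (proj1_sig y)),
    (fun x : {x : baire | P x} =>
       proj1_sig (constructive_indefinite_description (names (proj1_sig x)) (proj2_sig x))).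
  split; [|split].
  - apply baire_closed_polish; [|exact Hclosed].
    (* The space of names has to be inhabited; [H xzero] gives the constant loop a name. *)
    destruct (Hsurj (exist _ lconst lconst_is_loop)) as [x Hx].
    { simpl; rewrite winding_const; exact H0. }
    exists x; eexists; exact Hx.
  - intros x e He; destruct (Hsmall e He) as [k Hk].
    (* Agreement up to and including position [to_nat (1, k)] makes the two names share their step
       function number [k]. *)
    exists (/ INR (S (S (to_nat (1, k)%nat)))); split; [apply inv_S_pos|].
    intros y Hxy; apply Rlt_le, baire_dist_agree in Hxy.
    exists (2 * / INR (S k)); split; [exact Hk|]; intros s Hs.
    destruct (constructive_indefinite_description (names (proj1_sig x)) (proj2_sig x)) as [l Hl].
    destruct (constructive_indefinite_description (names (proj1_sig y)) (proj2_sig y)) as [l' Hl']; simpl.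
    apply Hclose with (proj1_sig x) (proj1_sig y); auto.
    apply Hxy; lia.
  - intros l; split.
    + intros Hl; destruct (Hsurj l Hl) as [x Hx].
      exists (exist P x (ex_intro _ l Hx)).
      destruct (constructive_indefinite_description _ _) as [l' Hl']; simpl in *.
      (* A name determines its loop, so the loop chosen for [x] is [l]. *)
      apply Loop_ext; intros s Hs; apply dist2_zero_of_small; intros e He.
      destruct (Hsmall e He) as [k Hk]; left; apply Rle_lt_trans with (2 := Hk).
      apply Hclose with x x; auto.
    + intros [x <-]; destruct (constructive_indefinite_description _ _) as [l' Hl']; simpl.
      unfold winding_preimage; apply HH; eexists; apply Hl'.
Qed.

Lemma true_analytic_exists :
  exists S : Loop -> Prop, union_of_normal_subgroup S /\ analytic S /\ ~ Borel S.
Proof.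
  destruct Sigma11_not_compl_exists as (A & HA & HnA); exists (span_loops A).
  split; [apply span_loops_normal|]; split.
  - apply analytic_winding_preimage; [apply span_zero|apply Sigma11_span, HA].
  - intros HB; apply HnA.
    apply (Borel_preimage_Sigma11 _ branch_loop branch_loop_continuous) in HB.
    destruct HB as [_ HB]; rewrite <- (span_loops_branch A); exact HB.
Qed.

Theorem theoremB :
  (* (1) true Sigma^0_g normal subgroups for every countable g >= 2 *)
  (forall g : ord, ord_le ord2 g ->
     exists S : Loop -> Prop, union_of_normal_subgroup S /\ true_Sigma0 g S) /\
  (* (2) true Pi^0_g normal subgroups for every countable g >= 1, g <> 2 *)
  (forall g : ord, ord_le ord1 g -> ~ ord_eq g ord2 ->
     exists S : Loop -> Prop, union_of_normal_subgroup S /\ true_Pi0 g S) /\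
  (* (3) a true analytic normal subgroup *)
  (exists S : Loop -> Prop, union_of_normal_subgroup S /\ analytic S /\ ~ Borel S).
Proof.
  split; [exact true_Sigma0_exists|].
  split; [exact true_Pi0_exists|exact true_analytic_exists].
Qed.
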